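(* Let $A=A(R,\sigma,t,\mu)$ be a locally finite twisted generalized Weyl algebra, where $R$ is a domain, and let $P_A=(p_{ij})_{i,j=1}^n$ be its matrix of minimal polynomials. Then: (a) $P_A$ is a polynomial Cartan matrix. (b) Writing $$p_{ij}(x)=x^{m_{ij}}+\lambda_{ij}^{(1)}x^{m_{ij}-1}+\cdots+\lambda_{ij}^{(m_{ij})},$$ where all $\lambda_{ij}^{(k)}\in\mathbb{K}$, the following identities hold in $A$ for any $i\neq j$: $$X_i^{m_{ij}}X_j+\lambda_{ij}^{(1)}\mu_{ij}^{-1} X_i^{m_{ij}-1}X_jX_i+\cdots+\lambda_{ij}^{(m_{ij})}\mu_{ij}^{-m_{ij}}X_jX_i^{m_{ij}}=0$$ and $$Y_jY_i^{m_{ij}}+\lambda_{ij}^{(1)}\mu_{ij}^{-1} Y_iY_jY_i^{m_{ij}-1}+\cdots+\lambda_{ij}^{(m_{ij})}\mu_{ij}^{-m_{ij}}Y_i^{m_{ij}}Y_j=0.$$ Moreover, for any $i\neq j$ and any integer $0\le m<m_{ij}$, the families $\{X_i^{m-k}X_jX_i^k\}_{k=0}^m$ and $\{Y_i^{m-k}Y_jY_i^k\}_{k=0}^m$ are linearly independent over $\mathbb{K}$ in $A$.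
   Context: $\mathbb{K}$ is an arbitrary field; all algebras are associative unital $\mathbb{K}$-algebras. Data: a positive integer $n$; a commutative $\mathbb{K}$-algebra $R$; an $n$-tuple $\sigma=(\sigma_1,\ldots,\sigma_n)$ of pairwise commuting $\mathbb{K}$-algebra automorphisms of $R$; an $n$-tuple $t=(t_1,\ldots,t_n)$ of nonzero elements of $R$; and a symmetric matrix $\mu=(\mu_{ij})_{i,j=1}^n$ with off-diagonal entries in $\mathbb{K}\setminus\{0\}$ (diagonal entries are undefined and irrelevant). It is required that $$t_it_j=\mu_{ij}\mu_{ji}\,\sigma_j^{-1}(t_i)\,\sigma_i^{-1}(t_j)\qquad\text{for all } i\neq j.$$ The twisted generalized Weyl construction (TGWC) $A'=A'(R,\sigma,t,\mu)$ is the algebra obtained from $R$ by adjoining noncommuting generators $X_1,\ldots,X_n,Y_1,\ldots,Y_n$ with defining relations, for all $i\neq j$ and $r\in R$: $X_ir=\sigma_i(r)X_i$, $Y_ir=\sigma_i^{-1}(r)Y_i$, $Y_iX_i=t_i$, $X_iY_i=\sigma_i(t_i)$, $X_iY_j=\mu_{ij}Y_jX_i$. It is $\mathbb{Z}^n$-graded by $\deg X_i=e_i$, $\deg Y_i=-e_i$, $\deg r=0$ for $r\in R$, where $(e_i)$ is the standard basis of $\mathbb{Z}^n$. Standing identification: the natural map $R\to A'$ is injective with image $A'_0$, so $A'_0=R$. Let $I\subseteq A'$ be the unique maximal graded two-sided ideal with $I\cap R=0$ (the sum of all graded ideals intersecting $R$ trivially). The twisted generalized Weyl algebra (TGWA)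 is $A=A(R,\sigma,t,\mu)=A'/I$; the images of $X_i,Y_i$ in $A$ are denoted by the same letters. For $i,j\in\{1,\ldots,n\}$ let $V_{ij}=\mathrm{Span}_{\mathbb{K}}\{\sigma_i^k(t_j)\mid k\in\mathbb{Z}\}\subseteq R$. $A$ is called locally finite if $\dim_{\mathbb{K}}V_{ij}<\infty$ for all $i,j$. For a locally finite $A$, the matrix of minimal polynomials is $P_A=(p_{ij})_{i,j=1}^n$, where $p_{ij}\in\mathbb{K}[x]$ is the (monic) minimal polynomial of $\sigma_i$ acting on $V_{ij}$; equivalently, the monic polynomial of minimal degree with $(p_{ij}(\sigma_i))(t_j)=0$. A polynomial Cartan matrix is a matrix $(p_{ij})_{i,j=1}^n$ of polynomials in $\mathbb{K}[x]$ such that for all $i\ne j$: $\deg p_{ij}\ge 1$, and $\deg p_{ij}=1$ if and only if $\deg p_{ji}=1$. Equivalently, $(1-\deg p_{ij})_{i,j}$ coincides off the diagonal with a generalized Cartan matrix. *)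

(* Defs.v *)
From HB Require Import structures.
From mathcomp Require Import all_boot all_order all_algebra generic_quotient.
From mathcomp Require Import finmap boolp.
From mathcomp Require Import monalg.

Set Implicit Arguments.
Unset Strict Implicit.
Unset Printing Implicit Defensive.

Import GRing.Theory.

Local Open Scope ring_scope.
Local Open Scope quotient_scope.

Record ideal (A : pzRingType) := Ideal {
  in_ideal :> A -> Prop;
  ideal0 : in_ideal 0;
  idealD : forall x y, in_ideal x -> in_ideal y -> in_ideal (x + y);
  idealMl : forall a x, in_ideal x -> in_ideal (a * x);
  idealMr : forall x a, in_ideal x -> in_ideal (x * a)
}.

Section IdealTheory.
Variable A : pzRingType.

Section Gen.
Variable S : A -> Prop.
Definition in_ideal_gen (x : A) : Prop :=
  forall J : ideal A, (forall s, S s -> J s) -> J x.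
Fact ideal_gen0 : in_ideal_gen 0. Proof. by move=> J _; exact: ideal0. Qed.
Fact ideal_genD x y : in_ideal_gen x -> in_ideal_gen y -> in_ideal_gen (x + y).
Proof. by move=> gx gy J hJ; apply: idealD; [exact: gx|exact: gy]. Qed.
Fact ideal_genMl a x : in_ideal_gen x -> in_ideal_gen (a * x).
Proof. by move=> gx J hJ; apply: idealMl; exact: gx. Qed.
Fact ideal_genMr x a : in_ideal_gen x -> in_ideal_gen (x * a).
Proof. by move=> gx J hJ; apply: idealMr; exact: gx. Qed.
Definition ideal_gen : ideal A :=
  Ideal ideal_gen0 ideal_genD ideal_genMl ideal_genMr.
Lemma ideal_genS s : S s -> ideal_gen s. Proof. by move=> Ss J; apply. Qed.
End Gen.

Variable I : ideal A.

Lemma idealN x : I x -> I (- x).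
Proof. by move=> Ix; rewrite -mulN1r; exact: idealMl. Qed.

Definition quot_equiv (x y : A) : bool := `[< I (x - y) >].

Fact quot_equiv_refl : reflexive quot_equiv.
Proof. by move=> x; apply/asboolP; rewrite subrr; exact: ideal0. Qed.
Fact quot_equiv_sym : symmetric quot_equiv.
Proof.
by move=> x y; apply/asboolP/asboolP=> /idealN; rewrite opprB.
Qed.
Fact quot_equiv_trans : transitive quot_equiv.
Proof.
move=> y x z /asboolP h1 /asboolP h2; apply/asboolP.
by have := idealD h1 h2; rewrite addrA subrK.
Qed.

Canonical quot_equiv_rel :=
  EquivRel quot_equiv quot_equiv_refl quot_equiv_sym quot_equiv_trans.

Definition quot := {eq_quot quot_equiv_rel}.

HB.instance Definition _ := EqQuotient.on quot.
HB.instance Definition _ := Choice.on quot.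

Definition quot_pi (x : A) : quot := \pi x.

Lemma quot_piP x y : quot_pi x = quot_pi y <-> I (x - y).
Proof.
split=> [/eqmodP /asboolP //|h]; apply/eqmodP; exact/asboolP.
Qed.

Lemma quot_reprK q : quot_pi (repr q) = q. Proof. exact: reprK. Qed.

Lemma quot_ind (P : quot -> Prop) : (forall x, P (quot_pi x)) -> forall q, P q.
Proof. by move=> h q; rewrite -[q]quot_reprK. Qed.

Lemma quot_repr x : I (repr (quot_pi x) - x).
Proof. by apply/quot_piP; rewrite quot_reprK. Qed.

Definition quot_opp (p : quot) : quot := quot_pi (- repr p).
Definition quot_add (p q : quot) : quot := quot_pi (repr p + repr q).
Definition quot_mul (p q : quot) : quot := quot_pi (repr p * repr q).
Lemma quot_oppE x : quot_opp (quot_pi x) = quot_pi (- x).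
Proof. by apply/quot_piP; rewrite -opprD; apply: idealN; exact: quot_repr. Qed.

Lemma quot_addE x y : quot_add (quot_pi x) (quot_pi y) = quot_pi (x + y).
Proof. by apply/quot_piP; rewrite opprD addrACA; apply: idealD; exact: quot_repr. Qed.

Lemma quot_mulE x y : quot_mul (quot_pi x) (quot_pi y) = quot_pi (x * y).
Proof.
apply/quot_piP; rewrite -(subrKA (x * repr (quot_pi y))) -mulrBl -mulrBr.
by apply: idealD; [apply: idealMr|apply: idealMl]; exact: quot_repr.
Qed.

Let qE := (quot_oppE, quot_addE, quot_mulE).

Fact quot_addA : associative quot_add.
Proof.
by elim/quot_ind=> x; elim/quot_ind=> y; elim/quot_ind=> z; rewrite !qE addrA.
Qed.
Fact quot_addC : commutative quot_add.
Proof. by elim/quot_ind=> x; elim/quot_ind=> y; rewrite !qE addrC. Qed.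
Fact quot_add0 : left_id (quot_pi 0) quot_add.
Proof. by elim/quot_ind=> x; rewrite !qE add0r. Qed.
Fact quot_addN : left_inverse (quot_pi 0) quot_opp quot_add.
Proof. by elim/quot_ind=> x; rewrite !qE addNr. Qed.

HB.instance Definition _ :=
  GRing.isZmodule.Build quot quot_addA quot_addC quot_add0 quot_addN.

Fact quot_mulA : associative quot_mul.
Proof.
by elim/quot_ind=> x; elim/quot_ind=> y; elim/quot_ind=> z; rewrite !qE mulrA.
Qed.
Fact quot_mul1l : left_id (quot_pi 1) quot_mul.
Proof. by elim/quot_ind=> x; rewrite !qE mul1r. Qed.
Fact quot_mul1r : right_id (quot_pi 1) quot_mul.
Proof. by elim/quot_ind=> x; rewrite !qE mulr1. Qed.
Fact quot_mulDl : left_distributive quot_mul +%R.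
Proof.
elim/quot_ind=> x; elim/quot_ind=> y; elim/quot_ind=> z.
by rewrite /GRing.add /= !qE mulrDl.
Qed.
Fact quot_mulDr : right_distributive quot_mul +%R.
Proof.
elim/quot_ind=> x; elim/quot_ind=> y; elim/quot_ind=> z.
by rewrite /GRing.add /= !qE mulrDr.
Qed.

HB.instance Definition _ := GRing.Zmodule_isPzRing.Build quot
  quot_mulA quot_mul1l quot_mul1r quot_mulDl quot_mulDr.

Lemma quot_pi0 : quot_pi 0 = 0. Proof. by []. Qed.
Lemma quot_pi1 : quot_pi 1 = 1. Proof. by []. Qed.
Lemma quot_piN : {morph quot_pi : x / - x}.
Proof. by move=> x; rewrite [RHS]quot_oppE. Qed.
Lemma quot_piD : {morph quot_pi : x y / x + y}.
Proof. by move=> x y; rewrite [RHS]quot_addE. Qed.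
Lemma quot_piM : {morph quot_pi : x y / x * y}.
Proof. by move=> x y; rewrite [RHS]quot_mulE. Qed.
End IdealTheory.

Section FreeAlgebra.
Variables (K : fieldType) (T : choiceType).

Definition free_alg := {malg K[{fmonom T}]}.

HB.instance Definition _ := GRing.Lalgebra.on free_alg.

Fact free_alg_scaleAr (c : K) (a b : free_alg) : c *: (a * b) = a * (c *: b).
Proof.
rewrite -!mul_malgC !mulrA; congr (_ * b).
rewrite !malgM_def fgmulUg fgmulgU; apply: eq_bigr => k _.
by rewrite mul1m mulm1 mulrC.
Qed.

Definition free_gen (x : T) : free_alg := << fmu x >>.

End FreeAlgebra.

Arguments free_gen {K T} x.

(* Two-sided inverses [sigmaV i] are carried along so that [sigma i] is an
   automorphism; diagonal entries of [mu] are unconstrained and never used. *)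
Record tgw_datum (K : fieldType) (R : comAlgType K) (n : nat) := TGWDatum {
  sigma : 'I_n -> {lrmorphism R -> R};
  sigmaV : 'I_n -> R -> R;
  tgw_t : 'I_n -> R;
  mu : 'M[K]_n;
  sigmaK : forall i, cancel (sigma i) (sigmaV i);
  sigmaVK : forall i, cancel (sigmaV i) (sigma i);
  sigma_comm : forall i j r, sigma i (sigma j r) = sigma j (sigma i r);
  tgw_t_neq0 : forall i, tgw_t i != 0;
  mu_neq0 : forall i j, i != j -> mu i j != 0;
  mu_sym : forall i j, i != j -> mu i j = mu j i;
  tgw_t_mul : forall i j, i != j ->
    tgw_t i * tgw_t j = (mu i j * mu j i) *: (sigmaV j (tgw_t i) * sigmaV i (tgw_t j))
}.

Section TGW.
Variables (K : fieldType) (R : comAlgType K) (n : nat) (D : tgw_datum R n).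

Let T : Type := (R + ('I_n + 'I_n))%type.
Let F := free_alg K T.
Let r_ (r : R) : F := free_gen (inl r).
Let x_ (i : 'I_n) : F := free_gen (inr (inl i)).
Let y_ (i : 'I_n) : F := free_gen (inr (inr i)).

(* The first four relations make r |-> r_ r a morphism of unital K-algebras. *)
Inductive tgwc_rel : F -> F -> Prop :=
| rel_add r s : tgwc_rel (r_ (r + s)) (r_ r + r_ s)
| rel_mul r s : tgwc_rel (r_ (r * s)) (r_ r * r_ s)
| rel_one : tgwc_rel (r_ 1) 1
| rel_scale (c : K) r : tgwc_rel (r_ (c *: r)) (c *: r_ r)
| rel_Xr i r : tgwc_rel (x_ i * r_ r) (r_ (sigma D i r) * x_ i)
| rel_Yr i r : tgwc_rel (y_ i * r_ r) (r_ (sigmaV D i r) * y_ i)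
| rel_YX i : tgwc_rel (y_ i * x_ i) (r_ (tgw_t D i))
| rel_XY i : tgwc_rel (x_ i * y_ i) (r_ (sigma D i (tgw_t D i)))
| rel_XYij i j : i != j -> tgwc_rel (x_ i * y_ j) (mu D i j *: (y_ j * x_ i)).

Definition tgwc_ideal : ideal F :=
  ideal_gen (fun a => exists u v, tgwc_rel u v /\ a = u - v).

Definition tgwc : Type := quot tgwc_ideal.

HB.instance Definition _ := GRing.PzRing.on tgwc.

Definition tgwc_pi (a : F) : tgwc := quot_pi tgwc_ideal a.

Lemma tgwc_piD : {morph tgwc_pi : a b / a + b}.
Proof. exact: (@quot_piD _ tgwc_ideal). Qed.
Lemma tgwc_piM : {morph tgwc_pi : a b / a * b}.
Proof. exact: (@quot_piM _ tgwc_ideal). Qed.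
Lemma tgwc_pi1 : tgwc_pi 1 = 1.
Proof. exact: (@quot_pi1 _ tgwc_ideal). Qed.
Lemma tgwc_piP a b : tgwc_pi a = tgwc_pi b <-> tgwc_ideal (a - b).
Proof. exact: quot_piP. Qed.
Lemma tgwc_ind (P : tgwc -> Prop) : (forall a, P (tgwc_pi a)) -> forall a, P a.
Proof. exact: (@quot_ind _ tgwc_ideal). Qed.

Definition tgwc_R (r : R) : tgwc := tgwc_pi (r_ r).
Definition tgwc_X (i : 'I_n) : tgwc := tgwc_pi (x_ i).
Definition tgwc_Y (i : 'I_n) : tgwc := tgwc_pi (y_ i).

Lemma tgwc_rel_pi u v : tgwc_rel u v -> tgwc_pi u = tgwc_pi v.
Proof.
move=> uv; apply/tgwc_piP; apply: ideal_genS.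
by exists u, v.
Qed.

Lemma tgwc_RD : {morph tgwc_R : r s / r + s}.
Proof. by move=> r s; rewrite /tgwc_R -tgwc_piD; exact: tgwc_rel_pi (rel_add _ _). Qed.
Lemma tgwc_RM : {morph tgwc_R : r s / r * s}.
Proof. by move=> r s; rewrite /tgwc_R -tgwc_piM; exact: tgwc_rel_pi (rel_mul _ _). Qed.
Lemma tgwc_R1 : tgwc_R 1 = 1.
Proof. by rewrite /tgwc_R -tgwc_pi1; exact: tgwc_rel_pi (rel_one). Qed.

Definition tgwc_scale (c : K) (a : tgwc) : tgwc := tgwc_R c%:A * a.

Fact tgwc_scaleA b c a : tgwc_scale b (tgwc_scale c a) = tgwc_scale (b * c) a.
Proof. by rewrite /tgwc_scale mulrA -tgwc_RM -scalerAl mul1r scalerA. Qed.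
Fact tgwc_scale1 : left_id 1 tgwc_scale.
Proof. by move=> a; rewrite /tgwc_scale scale1r tgwc_R1 mul1r. Qed.
Fact tgwc_scaleDr : right_distributive tgwc_scale +%R.
Proof. by move=> c a b; rewrite /tgwc_scale mulrDr. Qed.
Fact tgwc_scaleDl a : {morph tgwc_scale^~ a : b c / b + c}.
Proof. by move=> b c; rewrite /tgwc_scale scalerDl tgwc_RD mulrDl. Qed.

(* The library's [algType K] excludes the zero ring, so [tgwc] and [tgwa] are
   given separate ring and K-module structures; [tgwc_piZ], [tgwc_scaleAl] and
   [tgwc_scaleAr] say that they form a K-algebra. *)
HB.instance Definition _ := GRing.Zmodule_isLmodule.Build K tgwc
  tgwc_scaleA tgwc_scale1 tgwc_scaleDr tgwc_scaleDl.

Lemma tgwc_piZ (c : K) (a : F) : tgwc_pi (c *: a) = c *: tgwc_pi a.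
Proof.
rewrite -[RHS]/(tgwc_R c%:A * tgwc_pi a) /tgwc_R (tgwc_rel_pi (rel_scale _ _)).
rewrite -(mulr1 (r_ 1)) free_alg_scaleAr tgwc_piM (tgwc_rel_pi rel_one) tgwc_pi1.
by rewrite mul1r -tgwc_piM -scalerAl mul1r.
Qed.

Lemma tgwc_scaleAl (c : K) (a b : tgwc) : c *: (a * b) = (c *: a) * b.
Proof. exact: mulrA. Qed.

Lemma tgwc_scaleAr (c : K) (a b : tgwc) : c *: (a * b) = a * (c *: b).
Proof.
elim/tgwc_ind: a => a; elim/tgwc_ind: b => b.
by rewrite -tgwc_piM -!tgwc_piZ -tgwc_piM free_alg_scaleAr.
Qed.

(* [tgwc_homog d] is the component of degree d: the smallest family of additive
   subgroups that is compatible with products and contains the generators in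
   their prescribed degrees. *)
Inductive tgwc_homog : 'rV[int]_n -> tgwc -> Prop :=
| homog_R r : tgwc_homog 0 (tgwc_R r)
| homog_X i : tgwc_homog (delta_mx 0 i) (tgwc_X i)
| homog_Y i : tgwc_homog (- delta_mx 0 i) (tgwc_Y i)
| homog_0 d : tgwc_homog d 0
| homog_D d a b : tgwc_homog d a -> tgwc_homog d b -> tgwc_homog d (a + b)
| homog_M d e a b :
    tgwc_homog d a -> tgwc_homog e b -> tgwc_homog (d + e) (a * b).

Definition graded_ideal (J : ideal tgwc) : Prop :=
  forall a, J a -> exists2 s : seq tgwc, a = \sum_(b <- s) b &
    forall b, b \in s -> J b /\ exists d, tgwc_homog d b.

(* The ideal generated by a union of ideals is their sum. *)
Definition tgwa_ideal : ideal tgwc :=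
  ideal_gen (fun a => exists J : ideal tgwc,
    [/\ graded_ideal J, (forall r, J (tgwc_R r) -> tgwc_R r = 0) & J a]).

Definition tgwa : Type := quot tgwa_ideal.

HB.instance Definition _ := GRing.PzRing.on tgwa.

Definition tgwa_pi (a : tgwc) : tgwa := quot_pi tgwa_ideal a.

Lemma tgwa_piD : {morph tgwa_pi : a b / a + b}.
Proof. exact: (@quot_piD _ tgwa_ideal). Qed.
Lemma tgwa_piM : {morph tgwa_pi : a b / a * b}.
Proof. exact: (@quot_piM _ tgwa_ideal). Qed.
Lemma tgwa_pi1 : tgwa_pi 1 = 1.
Proof. exact: (@quot_pi1 _ tgwa_ideal). Qed.
Lemma tgwa_piP a b : tgwa_pi a = tgwa_pi b <-> tgwa_ideal (a - b).
Proof. exact: quot_piP. Qed.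
Lemma tgwa_ind (P : tgwa -> Prop) : (forall a, P (tgwa_pi a)) -> forall a, P a.
Proof. exact: (@quot_ind _ tgwa_ideal). Qed.

Definition tgwa_R (r : R) : tgwa := tgwa_pi (tgwc_R r).
Definition tgwa_X (i : 'I_n) : tgwa := tgwa_pi (tgwc_X i).
Definition tgwa_Y (i : 'I_n) : tgwa := tgwa_pi (tgwc_Y i).

Definition tgwa_scale (c : K) (a : tgwa) : tgwa := tgwa_R c%:A * a.

Lemma tgwa_scaleE (c : K) (a : tgwc) : tgwa_scale c (tgwa_pi a) = tgwa_pi (c *: a).
Proof. by rewrite /tgwa_scale /tgwa_R -tgwa_piM. Qed.

Fact tgwa_scaleA b c a : tgwa_scale b (tgwa_scale c a) = tgwa_scale (b * c) a.
Proof.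
by elim/tgwa_ind: a => a; rewrite !tgwa_scaleE scalerA.
Qed.
Fact tgwa_scale1 : left_id 1 tgwa_scale.
Proof. by elim/tgwa_ind=> a; rewrite tgwa_scaleE scale1r. Qed.
Fact tgwa_scaleDr : right_distributive tgwa_scale +%R.
Proof. by move=> c a b; rewrite /tgwa_scale mulrDr. Qed.
Fact tgwa_scaleDl a : {morph tgwa_scale^~ a : b c / b + c}.
Proof.
move=> b c; elim/tgwa_ind: a => a /=.
by rewrite !tgwa_scaleE scalerDl tgwa_piD.
Qed.

HB.instance Definition _ := GRing.Zmodule_isLmodule.Build K tgwa
  tgwa_scaleA tgwa_scale1 tgwa_scaleDr tgwa_scaleDl.

Lemma tgwa_piZ (c : K) (a : tgwc) : tgwa_pi (c *: a) = c *: tgwa_pi a.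
Proof. by rewrite -tgwa_scaleE. Qed.

Lemma tgwa_scaleAl (c : K) (a b : tgwa) : c *: (a * b) = (c *: a) * b.
Proof. exact: mulrA. Qed.

Lemma tgwa_scaleAr (c : K) (a b : tgwa) : c *: (a * b) = a * (c *: b).
Proof.
elim/tgwa_ind: a => a; elim/tgwa_ind: b => b.
by rewrite -tgwa_piM -!tgwa_piZ -tgwa_piM tgwc_scaleAr.
Qed.

Definition sigma_pow (i : 'I_n) (k : int) (r : R) : R :=
  match k with
  | Posz m => iter m (sigma D i) r
  | Negz m => iter m.+1 (sigmaV D i) r
  end.

End TGW.

Section LinearAlgebra.
Variables (K : fieldType) (V : lmodType K).
Implicit Types (W : V -> Prop) (f : V -> V) (p q : {poly K}).

Definition lin_span W (v : V) : Prop :=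
  exists (N : nat) (c : 'I_N -> K) (s : 'I_N -> V),
    (forall k, W (s k)) /\ v = \sum_k c k *: s k.

Definition fin_dim W : Prop :=
  exists (N : nat) (s : 'I_N -> V), (forall k, W (s k)) /\
    forall v, W v -> exists c : 'I_N -> K, v = \sum_k c k *: s k.

Definition lin_indep (N : nat) (s : 'I_N -> V) : Prop :=
  forall c : 'I_N -> K, \sum_k c k *: s k = 0 -> forall k, c k = 0.

Definition poly_act p f (v : V) : V := \sum_(k < size p) p`_k *: iter k f v.

Definition annihilates p f W : Prop := forall v, W v -> poly_act p f v = 0.

Definition is_min_poly f W p : Prop :=
  [/\ p \is monic, annihilates p f W &
      forall q, q \is monic -> annihilates q f W -> (size p <= size q)%N].

(* Junk value 0 when no nonzero polynomial in f annihilates W. *)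
Definition min_poly f W : {poly K} :=
  if pselect (exists p, is_min_poly f W p) is left h then projT1 (cid h) else 0.

End LinearAlgebra.

Section LocallyFinite.
Variables (K : fieldType) (R : comAlgType K) (n : nat) (D : tgw_datum R n).

Definition tgw_V (i j : 'I_n) : R -> Prop :=
  lin_span (fun v => exists k : int, v = sigma_pow D i k (tgw_t D j)).

Definition locally_finite : Prop := forall i j, fin_dim (tgw_V i j).

Definition min_poly_mx : 'M[{poly K}]_n :=
  \matrix_(i, j) min_poly (sigma D i) (tgw_V i j).

End LocallyFinite.

Definition poly_deg (K : fieldType) (p : {poly K}) : nat := (size p).-1.

Definition poly_cartan (K : fieldType) (n : nat) (P : 'M[{poly K}]_n) : Prop :=
  forall i j, i != j ->
    (1 <= poly_deg (P i j))%N /\ (poly_deg (P i j) = 1 <-> poly_deg (P j i) = 1)%N.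

(* Main.v *)
Require Import Defs.
From HB Require Import structures.
From mathcomp Require Import all_boot all_order all_algebra generic_quotient.
From mathcomp Require Import finmap boolp monalg.
Import GRing.Theory.
Local Open Scope ring_scope.

(** A homogeneous element of the algebra is tested for zero by moving it into
    degree 0. Write A' for the construction, A for its quotient. The relations
    X_i Y_j = mu_ij Y_j X_i together with X_i Y_i, Y_i X_i in R show that every
    word of degree 0 in the generators lies in R ([mon_deg0]), and a word times
    the opposite word (reversed, X and Y exchanged) is a nonzero element of the
    domain R ([mon_wopp]). Hence if S is homogeneous of degree d in A' and w is
    any one word of degree -d with w S = 0, then u S v = 0 for all words u, v for
    which this product has degree 0 ([homog_null_left]). Such an S generates a
    graded ideal that meets R trivially, so S = 0 in A ([null_tgwa_pi]).
    Conversely the ideal defining A meets R trivially, because the projection to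
    degree 0 vanishes on it ([tgwa_ideal_proj0]); so S = 0 in A forces w S = 0.

    For S = sum_k c_k X_i^(m-k) X_j X_i^k take w = Y_j Y_i^m. With
    T_m = Y_i^m X_i^m, a nonzero element of R,

      w S = sigma_j^-1(T_m) sum_k c_k mu_ij^k sigma_i^-k(t_j)

    ([serre_term_X]); the condition on t_i t_j is exactly what makes the first
    factor common to all the terms. A linear relation between Serre monomials is
    therefore a polynomial of degree at most m in sigma_i that annihilates t_j
    ([serre_X_eq0], and [serre_Y_eq0] for the Y's): the coefficients of the minimal
    polynomial p_ij give the relation of degree deg p_ij, and there is none of a
    smaller degree.

    As to the shape of the matrix, deg p_ij = 0 would mean t_j = 0, and
    deg p_ij = 1 means that t_j is an eigenvector of sigma_i. Cancelling t_j in
    the condition on t_i t_j then shows that t_i is an eigenvector of sigma_j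
    ([sigma_eigen_sym]). *)

Set Implicit Arguments.
Unset Strict Implicit.

(** * Ideals of a ring *)

Lemma ideal_sum (A : pzRingType) (I : ideal A) (J : Type) (s : seq J) (F : J -> A) :
  (forall j, I (F j)) -> I (\sum_(j <- s) F j).
Proof.
move=> IF; elim: s => [|j s IHs]; first by rewrite big_nil; apply: ideal0.
by rewrite big_cons; apply: idealD.
Qed.

Section CoreOfAdditiveMap.
Variables (A : pzRingType) (p : A -> A).
Hypotheses (p0 : p 0 = 0) (pD : {morph p : x y / x + y}).

Definition in_core (a : A) : Prop := forall b c, p (b * a * c) = 0.

Fact core0 : in_core 0.
Proof. by move=> b c; rewrite mulr0 mul0r. Qed.
Fact coreD x y : in_core x -> in_core y -> in_core (x + y).
Proof. by move=> hx hy b c; rewrite mulrDr mulrDl pD hx hy addr0. Qed.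
Fact coreMl a x : in_core x -> in_core (a * x).
Proof. by move=> hx b c; rewrite mulrA hx. Qed.
Fact coreMr x a : in_core x -> in_core (x * a).
Proof. by move=> hx b c; rewrite mulrA -(mulrA _ a) hx. Qed.

(** The largest two-sided ideal contained in the kernel of [p]. *)
Definition core : ideal A := Ideal core0 coreD coreMl coreMr.

End CoreOfAdditiveMap.

Section SumIdeal.
Variables (A : pzRingType) (H N : A -> Prop).

Definition sum_of (P : A -> Prop) (a : A) : Prop :=
  exists2 s : seq A, a = \sum_(b <- s) b & forall b, b \in s -> P b.

Lemma sum_of1 (P : A -> Prop) a : P a -> sum_of P a.
Proof.
by move=> Pa; exists [:: a]; [rewrite big_seq1|move=> b; rewrite inE => /eqP ->].
Qed.

Hypothesis spanH : forall a, sum_of H a.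
Hypothesis NMl : forall a x, H a -> N x -> N (a * x).
Hypothesis NMr : forall x a, N x -> H a -> N (x * a).

Fact sum_of0 : sum_of N 0.
Proof. by exists [::]; rewrite ?big_nil. Qed.

Fact sum_ofD a b : sum_of N a -> sum_of N b -> sum_of N (a + b).
Proof.
move=> [s -> hs] [s' -> hs']; exists (s ++ s'); first by rewrite big_cat.
by move=> c; rewrite mem_cat => /orP[/hs|/hs'].
Qed.

Fact sum_ofMl a x : sum_of N x -> sum_of N (a * x).
Proof.
move=> [s -> hs]; have [t -> ht] := spanH a.
exists [seq u * v | u <- t, v <- s].
  by rewrite big_allpairs_dep mulr_suml; apply: eq_bigr => u _; exact: mulr_sumr.
by move=> c /allpairsP [[u v] /= [/ht hu /hs hv ->]]; apply: NMl.
Qed.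

Fact sum_ofMr x a : sum_of N x -> sum_of N (x * a).
Proof.
move=> [s -> hs]; have [t -> ht] := spanH a.
exists [seq v * u | v <- s, u <- t].
  by rewrite big_allpairs_dep mulr_suml; apply: eq_bigr => u _; exact: mulr_sumr.
by move=> c /allpairsP [[v u] /= [/hs hv /ht hu ->]]; apply: NMr.
Qed.

(** When [H] is homogeneity and [N] singles out homogeneous elements, this ideal
    is graded by construction. *)
Definition sum_ideal : ideal A := Ideal sum_of0 sum_ofD sum_ofMl sum_ofMr.

End SumIdeal.

Lemma mulr_mid_eq0 (A : pzRingType) (a b c d e : A) :
  b * c * d = 0 -> a * b * c * (d * e) = 0.
Proof. by move=> h; rewrite mulrA -!(mulrA a) h mul0r mulr0. Qed.

Lemma mulr_mid2_eq0 (A : pzRingType) (a b c d : A) :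
  b * c = 0 -> a * b * (c * d) = 0.
Proof. by move=> h; rewrite mulrA -(mulrA a) h mulr0 mul0r. Qed.

(** * Grading of the free algebra *)

Section FreeGrading.
Variables (K : fieldType) (T : choiceType) (G : zmodType) (deg : T -> G).
Implicit Types (a b : free_alg K T) (k : {fmonom T}).

Definition mdegree k : G := \sum_(x <- (k : seq T)) deg x.

Lemma mdegree1 : mdegree mone = 0.
Proof. by rewrite /mdegree fm1 big_nil. Qed.

Lemma mdegreeM k l : mdegree (mmul k l) = mdegree k + mdegree l.
Proof. by rewrite /mdegree fmM big_cat. Qed.

Lemma mdegreeU x : mdegree (fmu x) = deg x.
Proof. by rewrite /mdegree fmU big_seq1. Qed.

Definition free_comp (d : G) a : free_alg K T :=
  [malg k in msupp a => if mdegree k == d then a@_k else 0].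

Lemma free_compE d a k : (free_comp d a)@_k = if mdegree k == d then a@_k else 0.
Proof.
by rewrite mcoeffE; case: ifP => // /negbT/mcoeff_outdom ->; rewrite if_same.
Qed.

Fact free_comp_is_zmod_morphism d : zmod_morphism (free_comp d).
Proof.
move=> a b; apply/malgP => k; rewrite mcoeffB !free_compE mcoeffB.
by case: ifP; rewrite ?subr0.
Qed.

HB.instance Definition _ d := GRing.isZmodMorphism.Build
  (free_alg K T) (free_alg K T) (free_comp d) (free_comp_is_zmod_morphism d).

Lemma free_compZ d c a : free_comp d (c *: a) = c *: free_comp d a.
Proof.
apply/malgP => k; rewrite mcoeffZ !free_compE mcoeffZ.
by case: ifP; rewrite ?mulr0.
Qed.

Lemma free_compU d c k :
  free_comp d << c *g k >> = if mdegree k == d then << c *g k >> else 0.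
Proof.
apply/malgP => l; rewrite free_compE (fun_if (mcoeff l)) mcoeff0 mcoeffU.
by case: (eqVneq k l) => [->|_]; rewrite ?mulr0n // !if_same.
Qed.

Lemma free_comp_comp d e a :
  free_comp d (free_comp e a) = if d == e then free_comp d a else 0.
Proof.
apply/malgP => k; rewrite (fun_if (mcoeff k)) mcoeff0 !free_compE.
case: (eqVneq d e) => [->|de]; first by case: (mdegree k == e).
by case: eqP => // ->; rewrite (negPf de).
Qed.

Lemma malgUU c c' k l :
  << c *g k >> * << c' *g l >> = << c * c' *g mmul k l >> :> free_alg K T.
Proof. by rewrite malgM_def fgmulUU. Qed.

Lemma free_compUl d c k a :
  free_comp d (<< c *g k >> * a) = << c *g k >> * free_comp (d - mdegree k) a.
Proof.
set e := d - _.
rewrite [a]monalgE mulr_sumr !raddf_sum mulr_sumr; apply: eq_bigr => l _.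
rewrite /= malgUU !free_compU mdegreeM.
have -> : (mdegree k + mdegree l == d) = (mdegree l == e).
  by rewrite [RHS]eq_sym subr_eq eq_sym addrC.
by case: ifP; rewrite ?mulr0 // malgUU.
Qed.

Lemma free_compUr d c k a :
  free_comp d (a * << c *g k >>) = free_comp (d - mdegree k) a * << c *g k >>.
Proof.
set e := d - _.
rewrite [a]monalgE mulr_suml !raddf_sum mulr_suml; apply: eq_bigr => l _.
rewrite /= malgUU !free_compU mdegreeM.
have -> : (mdegree l + mdegree k == d) = (mdegree l == e).
  by rewrite [RHS]eq_sym subr_eq eq_sym.
by case: ifP; rewrite ?mul0r // malgUU.
Qed.

Definition free_homog (d : G) a := free_comp d a = a.

Lemma free_homog0 d : free_homog d 0.
Proof. exact: raddf0. Qed.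

Lemma free_homogD d a b : free_homog d a -> free_homog d b -> free_homog d (a + b).
Proof. by move=> ha hb; rewrite /free_homog raddfD /= ha hb. Qed.

Lemma free_homogB d a b : free_homog d a -> free_homog d b -> free_homog d (a - b).
Proof. by move=> ha hb; rewrite /free_homog raddfB /= ha hb. Qed.

Lemma free_homogZ d c a : free_homog d a -> free_homog d (c *: a).
Proof. by move=> ha; rewrite /free_homog free_compZ ha. Qed.

Lemma free_homogM d e a b :
  free_homog d a -> free_homog e b -> free_homog (d + e) (a * b).
Proof.
move=> ha hb; rewrite /free_homog -{1}ha [free_comp d a]monalgE mulr_suml raddf_sum.
rewrite -[in RHS]ha [in RHS](monalgE (free_comp d a)) mulr_suml /=; apply: eq_bigr => k _.
rewrite free_compUl free_compE; case: eqP => [->|_]; last by rewrite monalgU0 !mul0r.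
by rewrite addrC addKr hb.
Qed.

Lemma free_homog_gen x : free_homog (deg x) (free_gen x).
Proof. by rewrite /free_homog /free_gen free_compU mdegreeU eqxx. Qed.

Lemma free_homog1 : free_homog 0 1.
Proof. by rewrite /free_homog -[1]/(<< mone >>) free_compU mdegree1 eqxx. Qed.

(** Multiplying by a monomial only shifts degrees, so the elements all of whose
    components lie in the ideal form an ideal themselves; it contains the
    generators because these are homogeneous. *)
Lemma free_homog_ideal_comp (S : free_alg K T -> Prop) :
  (forall s, S s -> exists d, free_homog d s) ->
  forall d a, ideal_gen S a -> ideal_gen S (free_comp d a).
Proof.
move=> hS d a Ia; move: d.
pose P a := forall d, ideal_gen S (free_comp d a).
have P0 : P 0 by move=> d; rewrite raddf0; apply: ideal0.
have PD x y : P x -> P y -> P (x + y).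
  by move=> hx hy d; rewrite raddfD; apply: idealD; [apply: hx|apply: hy].
have PMl x y : P y -> P (x * y).
  move=> hy d; rewrite [x]monalgE mulr_suml raddf_sum.
  apply: ideal_sum => k /=.
  by rewrite free_compUl; apply: (@idealMl _ (ideal_gen S)); apply: hy.
have PMr y x : P y -> P (y * x).
  move=> hy d; rewrite [x]monalgE mulr_sumr raddf_sum.
  apply: ideal_sum => k /=.
  by rewrite free_compUr; apply: (@Defs.idealMr _ (ideal_gen S)); apply: hy.
apply: (Ia (Ideal P0 PD PMl PMr)) => s Ss d.
have [e hs] := hS _ Ss; rewrite -hs free_comp_comp; case: eqP => [->|_].
  by rewrite hs; apply: ideal_genS.
exact: ideal0.
Qed.

End FreeGrading.

(** * Words in the generators *)

Section SigmaInverse.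
Variables (K : fieldType) (R : comAlgType K) (n : nat) (D : tgw_datum R n).
Variable i : 'I_n.

HB.instance Definition _ := GRing.isZmodMorphism.Build R R (sigmaV D i)
  (can2_zmod_morphism (@sigmaK _ _ _ D i) (@sigmaVK _ _ _ D i)).
HB.instance Definition _ := GRing.isMonoidMorphism.Build R R (sigmaV D i)
  (can2_monoid_morphism (@sigmaK _ _ _ D i) (@sigmaVK _ _ _ D i)).
HB.instance Definition _ := GRing.isScalable.Build K R R *:%R (sigmaV D i)
  (can2_scalable (@sigmaK _ _ _ D i) (@sigmaVK _ _ _ D i)).

End SigmaInverse.

(** Elements of an arbitrary ring that satisfy the defining relations. Everything
    derivable from the relations alone is proved at this generality. *)
Record tgw_rep (K : fieldType) (R : comAlgType K) (n : nat) (D : tgw_datum R n)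
    (A : pzRingType) := TGWRep {
  rep_R : R -> A;
  rep_X : 'I_n -> A;
  rep_Y : 'I_n -> A;
  rep_RD : {morph rep_R : r s / r + s};
  rep_RM : {morph rep_R : r s / r * s};
  rep_R1 : rep_R 1 = 1;
  rep_XR : forall i r, rep_X i * rep_R r = rep_R (sigma D i r) * rep_X i;
  rep_YR : forall i r, rep_Y i * rep_R r = rep_R (sigmaV D i r) * rep_Y i;
  rep_YX : forall i, rep_Y i * rep_X i = rep_R (tgw_t D i);
  rep_XY : forall i, rep_X i * rep_Y i = rep_R (sigma D i (tgw_t D i));
  rep_XYij : forall i j, i != j ->
    rep_X i * rep_Y j = rep_R (mu D i j)%:A * (rep_Y j * rep_X i)
}.

Arguments rep_R : simpl never.
Arguments rep_X : simpl never.
Arguments rep_Y : simpl never.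

Section Words.
Variables (K : fieldType) (R : comAlgType K) (n : nat) (D : tgw_datum R n).
Variables (A : pzRingType) (M : tgw_rep D A).

Notation ofR := (rep_R M).
Notation X := (rep_X M).
Notation Y := (rep_Y M).
Notation letter := ('I_n + 'I_n)%type.
Notation word := (seq letter).

Lemma rep_R0 : ofR 0 = 0.
Proof. by apply: (addIr (ofR 0)); rewrite -rep_RD !add0r. Qed.

Lemma rep_YXij i j : i != j -> Y j * X i = ofR (mu D i j)^-1%:A * (X i * Y j).
Proof.
move=> ij; rewrite (rep_XYij M ij) mulrA -rep_RM -scalerAl mul1r scalerA.
by rewrite mulVf ?(mu_neq0 _ ij) // scale1r rep_R1 mul1r.
Qed.

Definition gen (l : letter) : A := match l with inl i => X i | inr i => Y i end.
Definition letter_deg (l : letter) : 'rV[int]_n :=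
  match l with inl i => delta_mx 0 i | inr i => - delta_mx 0 i end.
Definition letter_twist (l : letter) : {lrmorphism R -> R} :=
  match l with inl i => sigma D i | inr i => sigmaV D i end.
Definition letter_opp (l : letter) : letter :=
  match l with inl i => inr i | inr i => inl i end.

Definition mon (w : word) : A := \prod_(l <- w) gen l.
Definition wdeg (w : word) : 'rV[int]_n := \sum_(l <- w) letter_deg l.
Definition twist (w : word) (r : R) : R := foldr (fun l => letter_twist l) r w.
Definition wopp (w : word) : word := rev (map letter_opp w).

Lemma mon_nil : mon [::] = 1. Proof. exact: big_nil. Qed.
Lemma mon_cons l w : mon (l :: w) = gen l * mon w. Proof. exact: big_cons. Qed.
Lemma mon_cat w w' : mon (w ++ w') = mon w * mon w'. Proof. exact: big_cat. Qed.
Lemma wdeg_cons l w : wdeg (l :: w) = letter_deg l + wdeg w. Proof. exact: big_cons. Qed.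
Lemma wdeg_cat w w' : wdeg (w ++ w') = wdeg w + wdeg w'. Proof. exact: big_cat. Qed.

Lemma gen_R l r : gen l * ofR r = ofR (letter_twist l r) * gen l.
Proof. by case: l => i; [exact: rep_XR|exact: rep_YR]. Qed.

Lemma mon_R w r : mon w * ofR r = ofR (twist w r) * mon w.
Proof.
elim: w => [|l w IHw]; first by rewrite mon_nil mul1r mulr1.
by rewrite mon_cons -mulrA IHw mulrA gen_R -mulrA.
Qed.

Lemma mon_mul r s w v :
  (ofR r * mon w) * (ofR s * mon v) = ofR (r * twist w s) * mon (w ++ v).
Proof. by rewrite mulrA -(mulrA (ofR r)) mon_R rep_RM mon_cat !mulrA. Qed.

Lemma woppK w : wopp (wopp w) = w.
Proof.
by rewrite /wopp map_rev revK -map_comp map_id_in // => -[].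
Qed.

Lemma twist_surj w r : exists s, twist w s = r.
Proof.
elim: w r => [|l w IHw] r; first by exists r.
have [s es] : exists s, letter_twist l s = r.
  by case: l => i /=; [exists (sigmaV D i r); rewrite sigmaVK
                      |exists (sigma D i r); rewrite sigmaK].
by have [u eu] := IHw s; exists u; rewrite /= eu.
Qed.

Lemma letter_twist_eq0 l r : (letter_twist l r == 0) = (r == 0).
Proof.
apply/eqP/eqP => [|->]; last exact: raddf0.
case: l => i /= h.
  by rewrite -(sigmaK D i r) h raddf0.
by rewrite -(sigmaVK D i r) h raddf0.
Qed.

Lemma twist_eq0 w r : (twist w r == 0) = (r == 0).
Proof. by elim: w => //= l w IHw; rewrite letter_twist_eq0. Qed.

Hypothesis R_domain : GRing.integral_domain_axiom R.

Lemma domain_mulf_eq0 (x y : R) : (x * y == 0) = (x == 0) || (y == 0).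
Proof.
apply/eqP/orP => [/R_domain/orP //|[] /eqP ->]; by rewrite ?mul0r ?mulr0.
Qed.

(** Words are regular up to [R]: cancelling the innermost pair first, each of the
    pairs X_i Y_i or Y_i X_i contributes a twist of t_i or of sigma_i(t_i), and
    these are nonzero in the domain [R]. *)
Lemma mon_wopp w : exists2 r, r != 0 & mon w * mon (wopp w) = ofR r.
Proof.
elim: w => [|l w [r r0 IHw]].
  by exists 1; rewrite ?oner_eq0 // /wopp /= mon_nil mulr1 rep_R1.
have [u u0 lu] : exists2 u, u != 0 & gen l * gen (letter_opp l) = ofR u.
  case: l => i /=.
    exists (sigma D i (tgw_t D i)); last exact: rep_XY.
    by rewrite (letter_twist_eq0 (inl i)) tgw_t_neq0.
  by exists (tgw_t D i); [exact: tgw_t_neq0|exact: rep_YX].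
exists (letter_twist l r * u); first by rewrite domain_mulf_eq0 letter_twist_eq0 negb_or r0.
rewrite /wopp /= rev_cons -cats1 mon_cat !mon_cons mon_nil mulr1.
by rewrite mulrA -(mulrA (gen l)) IHw gen_R -mulrA lu rep_RM.
Qed.

(** The letter Y_j commutes up to a scalar with each X_i that precedes the first
    X_j, and meets that X_j in Y_j X_j = t_j. *)
Lemma gen_Y_mon_X j xs : j \in xs ->
  exists r xs', perm_eq xs (j :: xs') /\
    Y j * mon (map inl xs) = ofR r * mon (map inl xs').
Proof.
elim: xs => // i xs IHxs; rewrite inE /= mon_cons /=.
case: (eqVneq j i) => [<- _|ji /= /IHxs [r [xs' [pxs e]]]].
  by exists (tgw_t D j), xs; rewrite mulrA rep_YX.
exists ((mu D i j)^-1%:A * sigma D i r), (i :: xs'); split.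
  by apply/permP => p; rewrite /= (permP pxs) /= addnCA.
rewrite mulrA rep_YXij 1?eq_sym // -!mulrA e (mulrA (X i)) rep_XR.
by rewrite /= mon_cons rep_RM !mulrA.
Qed.

Lemma gen_X_mon_Y i ys : exists r ys' xs,
  X i * mon (map inr ys) = ofR r * mon (map inr ys' ++ map inl xs) /\
  letter_deg (inl i) + wdeg (map inr ys) = wdeg (map inr ys' ++ map inl xs).
Proof.
elim: ys => [|j ys [r [ys' [xs [e d]]]]].
  exists 1, [::], [:: i]; rewrite rep_R1 mul1r /= mon_cons mon_nil wdeg_cons.
  by [].
rewrite /= mon_cons wdeg_cons /=.
case: (eqVneq i j) => [<-|ij].
  exists (sigma D i (tgw_t D i)), ys, [::]; rewrite /= cats0 mulrA rep_XY.
  by rewrite addNKr.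
exists ((mu D i j)%:A * sigmaV D j r), (j :: ys'), xs.
rewrite /= mon_cons wdeg_cons -d /= addrCA; split=> //.
by rewrite mulrA rep_XYij // -!mulrA e (mulrA (Y j)) rep_YR rep_RM !mulrA.
Qed.

(** The relations never exchange two X's or two Y's, but they do allow all Y's to
    be moved to the left of all X's. *)
Lemma mon_normal w : exists r ys xs,
  mon w = ofR r * mon (map inr ys ++ map inl xs) /\
  wdeg w = wdeg (map inr ys ++ map inl xs).
Proof.
elim: w => [|[i|i] w [r [ys [xs [e d]]]]].
- by exists 1, [::], [::]; rewrite rep_R1 mul1r.
- have [r' [ys' [xs' [e' d']]]] := gen_X_mon_Y i ys.
  exists (sigma D i r * r'), ys', (xs' ++ xs).
  rewrite map_cat catA mon_cat wdeg_cat -d' mon_cons wdeg_cons e d.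
  split; last by rewrite wdeg_cat addrA.
  by rewrite mulrA rep_XR -mulrA mon_cat (mulrA (X i)) e' rep_RM !mulrA.
- exists (sigmaV D i r), (i :: ys), xs.
  by rewrite /= !mon_cons !wdeg_cons e d mulrA rep_YR mulrA.
Qed.

Lemma wdeg_coord ys xs j :
  wdeg (map inr ys ++ map inl xs) 0 j = (count_mem j xs)%:Z - (count_mem j ys)%:Z.
Proof.
have hX zs : (\sum_(i <- zs) delta_mx 0 i : 'rV[int]_n) 0 j = (count_mem j zs)%:Z.
  elim: zs => [|i zs IH]; first by rewrite big_nil mxE.
  by rewrite big_cons mxE IH mxE eqxx /= PoszD (eq_sym j); case: eqP.
by rewrite wdeg_cat /wdeg !big_map /= sumrN mxE mxE !hX addrC.
Qed.

(** In a normal word of degree 0 the last Y has a matching X, so that it can be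
    absorbed into [R]; then the word is shorter. *)
Lemma mon_deg0 w : wdeg w = 0 -> exists r, mon w = ofR r.
Proof.
have [r [ys [xs [-> ->]]]] := mon_normal w.
suff H : wdeg (map inr ys ++ map inl xs) = 0 ->
    exists r, mon (map inr ys ++ map inl xs) = ofR r.
  by move=> /H [s ->]; exists (r * s); rewrite rep_RM.
elim/last_ind: ys xs => [|ys j IHys] xs d0.
  exists 1; rewrite rep_R1; case: xs d0 => [|j xs] d0; first by rewrite /= mon_nil.
  have := wdeg_coord [::] (j :: xs) j.
  by rewrite d0 mxE /= eqxx subr0.
have count0 i : count_mem i xs = count_mem i (rcons ys j).
  by apply/eqP; have := wdeg_coord (rcons ys j) xs i;
     rewrite d0 mxE => /esym/eqP; rewrite subr_eq0.
have jxs : j \in xs.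
  by rewrite -has_pred1 has_count count0 -cats1 count_cat /= eqxx addnC.
have [s [xs' [pxs e]]] := gen_Y_mon_X jxs.
have d0' : wdeg (map inr ys ++ map inl xs') = 0.
  apply/rowP => i; rewrite wdeg_coord mxE.
  have := count0 i; rewrite (permP pxs) -cats1 count_cat /= addnC.
  rewrite addn0 => /addIn ->; exact: subrr.
have [u eu] := IHys xs' d0'.
exists (twist (map inr ys) s * u).
rewrite map_rcons cat_rcons mon_cat mon_cons /= e mulrA mon_R.
by rewrite -mulrA -mon_cat eu rep_RM.
Qed.

End Words.

(** * Grading of the construction *)

Section TGWCRep.
Variables (K : fieldType) (R : comAlgType K) (n : nat) (D : tgw_datum R n).

Fact tgwc_XR i r : tgwc_X D i * tgwc_R D r = tgwc_R D (sigma D i r) * tgwc_X D i.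
Proof. by rewrite -!tgwc_piM; apply/tgwc_rel_pi/rel_Xr. Qed.

Fact tgwc_YR i r : tgwc_Y D i * tgwc_R D r = tgwc_R D (sigmaV D i r) * tgwc_Y D i.
Proof. by rewrite -!tgwc_piM; apply/tgwc_rel_pi/rel_Yr. Qed.

Fact tgwc_YX i : tgwc_Y D i * tgwc_X D i = tgwc_R D (tgw_t D i).
Proof. by rewrite -tgwc_piM; apply/tgwc_rel_pi/rel_YX. Qed.

Fact tgwc_XY i : tgwc_X D i * tgwc_Y D i = tgwc_R D (sigma D i (tgw_t D i)).
Proof. by rewrite -tgwc_piM; apply/tgwc_rel_pi/rel_XY. Qed.

Fact tgwc_XYij i j : i != j ->
  tgwc_X D i * tgwc_Y D j = tgwc_R D (mu D i j)%:A * (tgwc_Y D j * tgwc_X D i).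
Proof.
move=> ij; rewrite -[RHS]/(mu D i j *: (tgwc_Y D j * tgwc_X D i)).
by rewrite -!tgwc_piM -tgwc_piZ; apply/tgwc_rel_pi/rel_XYij.
Qed.

Definition tgwc_rep : tgw_rep D (tgwc D) :=
  TGWRep (@tgwc_RD _ _ _ D) (@tgwc_RM _ _ _ D) (@tgwc_R1 _ _ _ D)
    tgwc_XR tgwc_YR tgwc_YX tgwc_XY tgwc_XYij.

End TGWCRep.

Section TGWCGrading.
Variables (K : fieldType) (R : comAlgType K) (n : nat) (D : tgw_datum R n).

Notation T := (R + ('I_n + 'I_n))%type.
Notation F := (free_alg K T).

Definition gen_deg (x : T) : 'rV[int]_n :=
  match x with inl _ => 0 | inr l => letter_deg l end.

Notation fhomog := (free_homog gen_deg).

Lemma tgwc_rel_homog (u v : F) : tgwc_rel D u v -> exists d, fhomog d u /\ fhomog d v.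
Proof.
have hR r : fhomog 0 (free_gen (inl r)) := @free_homog_gen K _ _ gen_deg (inl r).
have hL l : fhomog (letter_deg l) (free_gen (inr l)) := @free_homog_gen K _ _ gen_deg (inr l).
have hRL r l : fhomog (letter_deg l) (free_gen (inl r) * free_gen (inr l) : F).
  by have := free_homogM (hR r) (hL l); rewrite add0r.
have hLR r l : fhomog (letter_deg l) (free_gen (inr l) * free_gen (inl r) : F).
  by have := free_homogM (hL l) (hR r); rewrite addr0.
have hLL k l := free_homogM (hL k) (hL l).
case=> [r s|r s||c r|i r|i r|i|i|i j ij].
- by exists 0; split=> //; apply: free_homogD.
- by exists 0; split=> //; have := free_homogM (hR r) (hR s); rewrite addr0.
- by exists 0; split=> //; apply: free_homog1.
- by exists 0; split=> //; apply: free_homogZ.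
- by exists (letter_deg (inl i)); split; [apply: hLR|apply: hRL].
- by exists (letter_deg (inr i)); split; [apply: hLR|apply: hRL].
- by exists 0; split=> //; have := hLL (inr i) (inl i); rewrite addNr.
- by exists 0; split=> //; have := hLL (inl i) (inr i); rewrite subrr.
exists (letter_deg (inl i) + letter_deg (inr j)); split; first exact: hLL.
by apply: free_homogZ; rewrite addrC; apply: hLL.
Qed.

Lemma tgwc_ideal_comp d (f : F) : tgwc_ideal D f -> tgwc_ideal D (free_comp gen_deg d f).
Proof.
apply: free_homog_ideal_comp => _ [u [v [uv ->]]].
have [e [hu hv]] := tgwc_rel_homog uv.
by exists e; apply: free_homogB.
Qed.

(** The degree zero component. It is well defined because the defining relations
    are homogeneous, and it is what makes the grading usable: a sum that lies in
    [R] equals the sum of its degree zero terms. *)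
Definition proj0 (a : tgwc D) : tgwc D :=
  tgwc_pi D (free_comp gen_deg 0 (repr (a : quot (tgwc_ideal D)))).

Lemma proj0_pi f : proj0 (tgwc_pi D f) = tgwc_pi D (free_comp gen_deg 0 f).
Proof.
apply/tgwc_piP; rewrite -raddfB; apply: tgwc_ideal_comp; exact: quot_repr.
Qed.

Lemma proj0D : {morph proj0 : a b / a + b}.
Proof.
elim/tgwc_ind=> f; elim/tgwc_ind=> g.
by rewrite -tgwc_piD !proj0_pi raddfD tgwc_piD.
Qed.

Lemma tgwc_pi0 : tgwc_pi D 0 = 0.
Proof. by apply: (addIr (tgwc_pi D 0)); rewrite -tgwc_piD !add0r. Qed.

Lemma proj00 : proj0 0 = 0.
Proof. by rewrite -tgwc_pi0 proj0_pi raddf0. Qed.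

Lemma homog_lift d a : tgwc_homog (D := D) d a ->
  exists2 f, fhomog d f & tgwc_pi D f = a.
Proof.
elim=> {d a} [r|i|i|d|d a b _ [f hf <-] _ [g hg <-]|d e a b _ [f hf <-] _ [g hg <-]].
- by exists (free_gen (inl r)) => //; exact: (@free_homog_gen K _ _ gen_deg (inl r)).
- by exists (free_gen (inr (inl i))) => //; exact: (@free_homog_gen K _ _ gen_deg (inr (inl i))).
- by exists (free_gen (inr (inr i))) => //; exact: (@free_homog_gen K _ _ gen_deg (inr (inr i))).
- by exists 0; [apply: free_homog0|apply: tgwc_pi0].
- by exists (f + g); [apply: free_homogD|apply: tgwc_piD].
- by exists (f * g); [apply: free_homogM|apply: tgwc_piM].
Qed.

Lemma proj0_homog0 a : tgwc_homog 0 a -> proj0 a = a.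
Proof. by case/homog_lift=> f hf <-; rewrite proj0_pi hf. Qed.

Lemma proj0_homog_neq0 d a : tgwc_homog d a -> d != 0 -> proj0 a = 0.
Proof.
case/homog_lift=> f hf <- d0; rewrite proj0_pi -hf free_comp_comp eq_sym.
by rewrite (negPf d0) tgwc_pi0.
Qed.

Lemma homogZ d (c : K) (a : tgwc D) : tgwc_homog d a -> tgwc_homog d (c *: a).
Proof. by move=> ha; rewrite -[d]add0r; apply: homog_M ha; apply: homog_R. Qed.

Lemma monomial_homog (c : K) k : exists d, tgwc_homog d (tgwc_pi D << c *g k >>).
Proof.
have -> : << c *g k >> = c *: << k >> :> F.
  by apply/malgP => l; rewrite mcoeffZ !mcoeffU mulrnAr mulr1.
rewrite tgwc_piZ; suff [d hd] : exists d, tgwc_homog d (tgwc_pi D << k >>).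
  by exists d; apply: homogZ.
case: k => s; elim: s => [|x s [d hd]].
  exists 0; rewrite -[<< _ >>]/(<< FMonom [::] >>) -fmoneE.
  by rewrite -[<< _ >>]/(1 : F) tgwc_pi1 -tgwc_R1; apply: homog_R.
exists (gen_deg x + d).
have -> : << FMonom (x :: s) >> = free_gen x * << FMonom s >> :> F.
  by rewrite /free_gen malgUU mulr1 fmuE /mmul /= fmmulE.
rewrite tgwc_piM; apply: homog_M hd.
by case: x => [r|[i|i]]; [apply: homog_R|apply: homog_X|apply: homog_Y].
Qed.

Lemma homog_span (a : tgwc D) : exists2 s : seq (tgwc D), a = \sum_(b <- s) b &
  forall b, b \in s -> exists d, tgwc_homog d b.
Proof.
elim/tgwc_ind: a => f.
exists [seq tgwc_pi D << f@_k *g k >> | k <- msupp f].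
  by rewrite big_map {1}[f]monalgE (big_morph _ (@tgwc_piD _ _ _ D) tgwc_pi0).
by move=> b /mapP [k _ ->]; apply: monomial_homog.
Qed.

End TGWCGrading.

(* From here on only the laws of the two quotient algebras are used, never the
   way in which their elements and operations are built. *)
Local Opaque tgwc_R tgwc_X tgwc_Y tgwc_pi quot_mul quot_add quot_opp tgwc_scale
  proj0 tgwa_pi tgwa_scale.

(** * Detecting zero in degree zero *)

Section Homogeneous.
Variables (K : fieldType) (R : comAlgType K) (n : nat) (D : tgw_datum R n).

Notation M := (tgwc_rep D).
Notation letter := ('I_n + 'I_n)%type.
Notation word := (seq letter).
Notation homog := (@tgwc_homog K R n D).

Lemma gen_homog l : homog (letter_deg l) (gen M l).
Proof. by case: l => i; [exact: homog_X|exact: homog_Y]. Qed.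

Lemma mon_homog w : homog (wdeg w) (mon M w).
Proof.
elim: w => [|l w IHw].
  by rewrite /wdeg mon_nil big_nil -(rep_R1 M); apply: homog_R.
by rewrite wdeg_cons mon_cons; apply: homog_M IHw; apply: gen_homog.
Qed.

Lemma homog_mons d a : homog d a ->
  exists2 s : seq (R * word), a = \sum_(p <- s) rep_R M p.1 * mon M p.2 &
    forall p, p \in s -> wdeg p.2 = d.
Proof.
have one l : gen M l = \sum_(p <- [:: (1, [:: l])]) rep_R M p.1 * mon M p.2.
  by rewrite big_seq1 mon_cons mon_nil mulr1 rep_R1 mul1r.
have degone l (p : R * word) : p \in [:: (1, [:: l])] -> wdeg p.2 = letter_deg l.
  by rewrite inE => /eqP ->; apply: big_seq1.
elim=> {d a} [r|i|i|d|d a b _ [s -> hs] _ [s' -> hs']|d e a b _ [s -> hs] _ [s' -> hs']].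
- exists [:: (r, [::])]; first by rewrite big_seq1 mon_nil mulr1.
  by move=> p; rewrite inE => /eqP ->; apply: big_nil.
- by exists [:: (1, [:: inl i])]; [exact: one (inl i)|exact: degone].
- by exists [:: (1, [:: inr i])]; [exact: one (inr i)|exact: degone].
- by exists [::]; rewrite ?big_nil.
- exists (s ++ s'); first by rewrite big_cat.
  by move=> p; rewrite mem_cat => /orP[/hs|/hs'].
exists [seq (p.1 * twist D p.2 q.1, p.2 ++ q.2) | p <- s, q <- s'].
  rewrite mulr_suml big_allpairs_dep; apply: eq_bigr => p _.
  rewrite mulr_sumr; apply: eq_bigr => q _ /=.
  exact: (mon_mul M).
by move=> p /allpairsP [[x y] /= [/hs <- /hs' <- ->]]; rewrite wdeg_cat.
Qed.

Lemma homog0_R a : homog 0 a -> exists r, a = rep_R M r.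
Proof.
case/homog_mons=> s -> hs.
elim: s hs => [|p s IHs] hs; first by exists 0; rewrite big_nil rep_R0.
have [r e] : exists r, mon M p.2 = rep_R M r by apply/mon_deg0/hs/mem_head.
have [u eu] := IHs (fun q qs => hs q (mem_behead (s := p :: s) qs)).
by exists (p.1 * r + u); rewrite big_cons e eu rep_RD rep_RM.
Qed.

(** A homogeneous element of such an ideal either has nonzero degree or lies in
    [R], and in the second case it is 0. *)
Lemma graded_ideal_proj0 (I : ideal (tgwc D)) :
  graded_ideal I -> (forall r, I (tgwc_R D r) -> tgwc_R D r = 0) ->
  forall a, I a -> proj0 a = 0.
Proof.
move=> gI IR a /gI [t -> ht].
elim: t ht => [|b t IHt] ht; first by rewrite big_nil proj00.
rewrite big_cons proj0D IHt ?addr0; last by move=> c ct; apply: ht; rewrite inE ct orbT.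
have [Ib [d hb]] := ht b (mem_head _ _).
have [d0|d0] := eqVneq d 0; last exact: proj0_homog_neq0 hb d0.
rewrite d0 in hb; have [r e] := homog0_R hb.
by rewrite (proj0_homog0 hb) e; apply: IR; rewrite -[tgwc_R D r]e.
Qed.

(** Each graded ideal that meets [R] trivially lies in the largest two-sided ideal
    on which the degree zero component vanishes, hence so does the sum of all of
    them; in particular this sum meets [R] trivially. *)
Lemma tgwa_ideal_proj0 a : tgwa_ideal D a -> proj0 a = 0.
Proof.
move=> Ia; have := Ia (core (@proj00 _ _ _ D) (@proj0D _ _ _ D)).
move=> /(_ _ 1 1); rewrite mul1r mulr1; apply.
move=> s [J [gJ JR Js]] b c; apply: graded_ideal_proj0 gJ JR _ _ => //.
by apply: Defs.idealMr; apply: idealMl.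
Qed.

Lemma tgwa_pi_R_eq0 r : injective (tgwc_R D) -> tgwa_pi (tgwc_R D r) = 0 -> r = 0.
Proof.
move=> injR /(tgwa_piP (D := D) _ 0); rewrite subr0 => /tgwa_ideal_proj0.
rewrite proj0_homog0; last exact: homog_R.
by move=> e; apply: injR; rewrite e; apply/esym/(rep_R0 M).
Qed.

Section Criterion.
Hypothesis R_domain : GRing.integral_domain_axiom R.
Hypothesis R_embeds : injective (tgwc_R D).

Lemma rep_R_eq0 r : rep_R M r = 0 -> r = 0.
Proof. by rewrite -(rep_R0 M) => /R_embeds. Qed.

(** The homogeneous elements in the radical of the pairing with values in the
    degree zero component; they turn out to be those that vanish in the quotient. *)
Definition null (x : tgwc D) : Prop :=
  exists2 d, homog d x & forall e f b c,
    homog e b -> homog f c -> e + d + f = 0 -> b * x * c = 0.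

Lemma nullMl a x : (exists e, homog e a) -> null x -> null (a * x).
Proof.
move=> [e ha] [d hx nx]; exists (e + d); first exact: homog_M.
move=> e' f b c hb hc e0; rewrite mulrA; apply: (nx (e' + e) f) => //.
  exact: homog_M.
by rewrite -(addrA e').
Qed.

Lemma nullMr x a : null x -> (exists e, homog e a) -> null (x * a).
Proof.
move=> [d hx nx] [e ha]; exists (d + e); first exact: homog_M.
move=> e' f b c hb hc e0; rewrite mulrA -(mulrA _ a); apply: (nx e' (e + f)) => //.
  exact: homog_M.
by rewrite addrA -(addrA e').
Qed.

(** The sums of null elements form a graded ideal; a null element of degree zero
    is 0, as one sees by multiplying it by 1 on both sides. *)
Lemma null_tgwa_pi x : null x -> tgwa_pi x = 0.
Proof.
move=> nx; apply/(tgwa_piP (D := D) x 0); rewrite subr0; apply: ideal_genS.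
exists (sum_ideal (@homog_span _ _ _ D) nullMl nullMr); split; last exact: sum_of1.
- move=> a [s e hs]; exists s => // b bs; split; last by have [d hb _] := hs b bs; exists d.
  exact/sum_of1/hs.
- move=> r [s e hs]; rewrite -(proj0_homog0 (homog_R D r)) e {e}.
  elim: s hs => [|b s IHs] hs; first by rewrite big_nil proj00.
  rewrite big_cons proj0D IHs ?addr0; last by move=> c cs; apply: hs; rewrite inE cs orbT.
  have [d hb nb] := hs b (mem_head _ _).
  have [d0|d0] := eqVneq d 0; last exact: proj0_homog_neq0 hb d0.
  have h1 : homog 0 1 by rewrite -(rep_R1 M); apply: homog_R.
  have := nb 0 0 1 1 h1 h1; rewrite d0 !addr0 mul1r mulr1 => /(_ erefl) ->.
  exact: proj00.
Qed.

(** One word of degree -d decides. Let w' be the word opposite to [w]. For a word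
    [u] of degree -d, u S lies in [R] and w' w is a nonzero element of [R], so
    that u S equals u w' w S = 0 up to a nonzero factor. If deg u + d + deg v = 0,
    then v (u S v) v' = (v u) S (v v') is 0 by the first case, since v u has
    degree -d; as u S v lies in [R] and v v' is nonzero, u S v = 0. *)
Lemma homog_null_left d (S : tgwc D) (w : word) :
  homog d S -> wdeg w = - d -> mon M w * S = 0 -> null S.
Proof.
move=> hS hw wS0.
have monS u : wdeg u = - d -> mon M u * S = 0.
  move=> hu.
  have : homog 0 (mon M u * S).
    by rewrite -(addNr d) -hu; apply: homog_M hS; apply: mon_homog.
  case/homog0_R=> r e; rewrite e; have [q q0 eq] := mon_wopp M R_domain (wopp w).
  have : mon M u * (mon M (wopp w) * mon M (wopp (wopp w))) * S = 0.
    by rewrite woppK -!mulrA wS0 !mulr0.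
  rewrite eq mon_R -mulrA e -rep_RM => /rep_R_eq0/eqP.
  by rewrite (domain_mulf_eq0 R_domain) twist_eq0 (negPf q0) => /eqP ->; apply: rep_R0.
exists d; first exact: hS.
move=> e f b c hb hc edf.
have monSmon u v : wdeg u = e -> wdeg v = f -> mon M u * S * mon M v = 0.
  move=> hu hv.
  have : homog 0 (mon M u * S * mon M v).
    rewrite -edf -hu -hv; apply: homog_M (mon_homog v).
    by apply: homog_M hS; apply: mon_homog.
  case/homog0_R=> r eqr; rewrite eqr; have [q q0 eq] := mon_wopp M R_domain v.
  have vu : wdeg (v ++ u) = - d.
    by rewrite wdeg_cat hu hv; apply/eqP; rewrite -addr_eq0 -addrA addrC edf.
  have : mon M v * rep_R M r * mon M (wopp v) = 0.
    by rewrite -eqr !mulrA -mon_cat (monS _ vu) !mul0r.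
  rewrite mon_R -mulrA eq -rep_RM => /rep_R_eq0/eqP.
  by rewrite (domain_mulf_eq0 R_domain) twist_eq0 (negPf q0) orbF => /eqP ->; apply: rep_R0.
have [s -> hs] := homog_mons hb; have [t -> ht] := homog_mons hc.
rewrite !mulr_suml; apply: big1_seq => -[r u] /andP[_ /hs hu].
rewrite mulr_sumr; apply: big1_seq => -[r' v] /andP[_ /ht hv].
(* The coefficient is moved to the right end, out of the way of u S v. *)
have [r'' <-] := twist_surj D v r'.
by rewrite -mon_R; apply: mulr_mid_eq0; apply: monSmon.
Qed.

Lemma tgwa_pi_eq0_left d (S : tgwc D) (w : word) :
  homog d S -> wdeg w = - d -> tgwa_pi S = 0 <-> mon M w * S = 0.
Proof.
move=> hS hw; split=> [S0|wS0]; last exact: null_tgwa_pi (homog_null_left hS hw wS0).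
have : homog 0 (mon M w * S) by rewrite -(addNr d) -hw; apply: homog_M hS; apply: mon_homog.
case/homog0_R=> r e; suff r0 : r = 0 by rewrite e r0; apply: rep_R0.
by apply: (tgwa_pi_R_eq0 R_embeds); rewrite -[tgwc_R D r]e tgwa_piM S0 mulr0.
Qed.

(** Reduces to the other side: w S is an element r of [R] because its degree is 0,
    and r w = w (S w) = 0 forces r = 0. *)
Lemma tgwa_pi_eq0_right d (S : tgwc D) (w : word) :
  homog d S -> wdeg w = - d -> tgwa_pi S = 0 <-> S * mon M w = 0.
Proof.
move=> hS hw; split=> [S0|Sw0].
  have : homog 0 (S * mon M w) by rewrite -(subrr d) -hw; apply: homog_M hS _; apply: mon_homog.
  case/homog0_R=> r e; suff r0 : r = 0 by rewrite e r0; apply: rep_R0.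
  by apply: (tgwa_pi_R_eq0 R_embeds); rewrite -[tgwc_R D r]e tgwa_piM S0 mul0r.
apply/(tgwa_pi_eq0_left hS hw).
have : homog 0 (mon M w * S) by rewrite -(addNr d) -hw; apply: homog_M hS; apply: mon_homog.
case/homog0_R=> r e; rewrite e; have [q q0 eq] := mon_wopp M R_domain w.
have : mon M w * S * (mon M w * mon M (wopp w)) = 0.
  exact: mulr_mid2_eq0.
rewrite e eq -rep_RM => /rep_R_eq0/eqP.
by rewrite (domain_mulf_eq0 R_domain) (negPf q0) orbF => /eqP ->; apply: rep_R0.
Qed.

End Criterion.
End Homogeneous.

(** * Products of Serre monomials with opposite words *)

Section SerreTerms.
Variables (K : fieldType) (R : comAlgType K) (n : nat) (D : tgw_datum R n).
Implicit Types (i j : 'I_n) (r : R) (c : K).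

Notation tau i k := (iter k (sigmaV D i)).
Notation t := (tgw_t D).

Lemma tau_sigma i b r : tau i b (iter b (sigma D i) r) = r.
Proof. by elim: b => //= b IHb; rewrite -[sigmaV D i _]iterS iterSr sigmaK. Qed.

Lemma tau_inj i m : injective (tau i m).
Proof. by elim: m => //= m IHm r s /(can_inj (@sigmaVK _ _ _ D i))/IHm. Qed.

Lemma tau0 i m : tau i m 0 = 0.
Proof. by elim: m => //= m ->; rewrite raddf0. Qed.

Lemma tauD i m r s : tau i m (r + s) = tau i m r + tau i m s.
Proof. by elim: m => //= m ->; rewrite raddfD. Qed.

Lemma tauZ i k c r : tau i k (c *: r) = c *: tau i k r.
Proof. by elim: k => //= k ->; rewrite linearZ. Qed.

Lemma sigmaV_comm i j r : sigmaV D i (sigmaV D j r) = sigmaV D j (sigmaV D i r).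
Proof.
apply: (can_inj (@sigmaK _ _ _ D i)); apply: (can_inj (@sigmaK _ _ _ D j)).
by rewrite sigmaVK [in RHS]sigma_comm !sigmaVK.
Qed.

Lemma tau_sigmaV i j k r : tau i k (sigmaV D j r) = sigmaV D j (tau i k r).
Proof. by elim: k => //= k ->; rewrite sigmaV_comm. Qed.

(** The value of Y_i^k X_i^k. *)
Fixpoint tprod i k : R := if k is k'.+1 then sigmaV D i (tprod i k') * t i else 1.

Lemma tprodD i a b : tprod i (a + b) = tau i b (tprod i a) * tprod i b.
Proof.
elim: b => [|b IHb]; first by rewrite addn0 mulr1.
by rewrite addnS /= IHb rmorphM mulrA.
Qed.

(** The compatibility condition t_i t_j = mu_ij mu_ji sigma_j^-1(t_i) sigma_i^-1(t_j),
    iterated k times along sigma_i^-1. *)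
Lemma tprod_t i j k : i != j ->
  tprod i k * t j = (mu D i j ^+ 2) ^+ k *: (sigmaV D j (tprod i k) * tau i k (t j)).
Proof.
move=> ij; elim: k => [|k IHk]; first by rewrite /= rmorph1 scale1r.
have h := congr1 (sigmaV D i) IHk.
rewrite rmorphM linearZ rmorphM /= in h.
rewrite /= -mulrA (tgw_t_mul D ij) -(mu_sym D ij) -expr2.
rewrite -scalerAr mulrCA h -scalerAr scalerA -exprS; congr (_ *: _).
by rewrite rmorphM sigmaV_comm mulrCA mulrA.
Qed.

Section Representation.
Variables (A : pzRingType) (M : tgw_rep D A).
Notation ofR := (rep_R M).
Notation X := (rep_X M).
Notation Y := (rep_Y M).

Lemma expY_R i k r : Y i ^+ k * ofR r = ofR (tau i k r) * Y i ^+ k.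
Proof.
elim: k => [|k IHk]; first by rewrite !expr0 mul1r mulr1.
by rewrite exprS -mulrA IHk mulrA rep_YR -mulrA.
Qed.

Lemma expY_expX i k : Y i ^+ k * X i ^+ k = ofR (tprod i k).
Proof.
elim: k => [|k IHk]; first by rewrite !expr0 mulr1 rep_R1.
rewrite exprS exprSr mulrA -(mulrA (Y i)) IHk rep_YR -mulrA rep_YX.
by rewrite -rep_RM.
Qed.

Lemma scalar_X c i : ofR c%:A * X i = X i * ofR c%:A.
Proof. by rewrite rep_XR linearZ rmorph1. Qed.

Lemma scalar_Y c i : ofR c%:A * Y i = Y i * ofR c%:A.
Proof. by rewrite rep_YR linearZ rmorph1. Qed.

Lemma scalar_expX c i k : ofR c%:A * X i ^+ k = X i ^+ k * ofR c%:A.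
Proof. by apply: commrX; apply: scalar_X. Qed.

Lemma expY_X i j k : i != j ->
  Y i ^+ k * X j = ofR ((mu D i j)^-1 ^+ k)%:A * (X j * Y i ^+ k).
Proof.
move=> ij; have ji : j != i by rewrite eq_sym.
elim: k => [|k IHk]; first by rewrite !expr0 mul1r mulr1 scale1r rep_R1 mul1r.
rewrite exprS -mulrA IHk mulrA -scalar_Y -mulrA (mulrA (Y i)).
rewrite (rep_YXij M ji) -(mu_sym D ij) !mulrA -rep_RM.
by rewrite -scalerAl mul1r scalerA -exprSr -!mulrA.
Qed.

Lemma Y_expX i j k : i != j ->
  Y j * X i ^+ k = ofR ((mu D i j)^-1 ^+ k)%:A * (X i ^+ k * Y j).
Proof.
move=> ij.
elim: k => [|k IHk]; first by rewrite !expr0 mul1r mulr1 scale1r rep_R1 mul1r.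
rewrite exprSr mulrA IHk -!mulrA (rep_YXij M ij).
rewrite (mulrA (X i ^+ k)) -scalar_expX !mulrA -rep_RM.
by rewrite -scalerAl mul1r scalerA -exprSr -!mulrA.
Qed.

(** By the compatibility condition sigma_j^-1(tprod i k) can be extracted from
    tprod i k * t_j, after which the twisted factors recombine into a product that
    depends on the total degree only. This is the common factor of all the terms
    of a Serre relation. *)
Lemma serre_coef i j a b : i != j ->
  (mu D i j)^-1 ^+ b *: (sigmaV D j (tau i b (tprod i a)) * (tprod i b * t j)) =
  mu D i j ^+ b *: (sigmaV D j (tprod i (a + b)) * tau i b (t j)).
Proof.
move=> ij; rewrite (tprod_t _ ij) tprodD rmorphM -scalerAr scalerA mulrA.
congr (_ *: _); rewrite exprVn -exprM mul2n -addnn exprD mulKf //.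
by rewrite expf_neq0 // mu_neq0.
Qed.

Lemma serre_term_X i j a b : i != j ->
  Y j * Y i ^+ (a + b) * (X i ^+ a * X j * X i ^+ b) =
  ofR (mu D i j ^+ b *: (sigmaV D j (tprod i (a + b)) * tau i b (t j))).
Proof.
move=> ij; rewrite -(serre_coef _ _ ij) [in LHS]addnC exprD.
rewrite -!mulrA (mulrA (Y i ^+ a)) expY_expX.
rewrite (mulrA (Y i ^+ b)) expY_R -!mulrA (mulrA (Y i ^+ b)) (expY_X b ij).
rewrite -!mulrA expY_expX (mulrA (ofR _) (ofR _)) -rep_RM (mulrA (Y j)) rep_YR.
rewrite -!mulrA (mulrA (Y j)) rep_YX -!rep_RM; congr ofR.
by rewrite -scalerAr mulr1 linearZ -scalerAl (mulrC (t j)).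
Qed.

Lemma serre_term_Y i j a b : i != j ->
  (Y i ^+ b * Y j * Y i ^+ a) * (X i ^+ (a + b) * X j) =
  ofR (mu D i j ^+ b *: (sigmaV D j (tprod i (a + b)) * tau i b (t j))).
Proof.
move=> ij; rewrite -(serre_coef _ _ ij) [in LHS]exprD.
rewrite -!mulrA (mulrA (Y i ^+ a)) expY_expX.
rewrite (mulrA (Y j)) rep_YR -!mulrA (mulrA (Y j)) (Y_expX b ij) -!mulrA rep_YX.
rewrite (mulrA (ofR _) (ofR _)) -rep_RM (mulrA (Y i ^+ b)) expY_R -!mulrA.
rewrite (mulrA (Y i ^+ b)) expY_expX -!rep_RM; congr ofR.
by rewrite -scalerAr mulr1 tauZ tau_sigmaV -scalerAl.
Qed.

End Representation.
End SerreTerms.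

(** * Serre relations as polynomial identities *)

Section SerreSums.
Variables (K : fieldType) (R : comAlgType K) (n : nat) (D : tgw_datum R n).
Hypothesis R_domain : GRing.integral_domain_axiom R.
Hypothesis R_embeds : injective (tgwc_R D).

Notation M := (tgwc_rep D).
Notation homog := (@tgwc_homog K R n D).
Notation tau i k := (iter k (sigmaV D i)).
Notation t := (tgw_t D).

Lemma tgwa_pi0 : tgwa_pi (0 : tgwc D) = 0.
Proof. by apply: (addIr (tgwa_pi (0 : tgwc D))); rewrite -tgwa_piD !add0r. Qed.

Lemma tgwa_piX (a : tgwc D) k : tgwa_pi (a ^+ k) = tgwa_pi a ^+ k.
Proof.
elim: k => [|k IHk]; first by rewrite !expr0; apply: tgwa_pi1.
by rewrite !exprS tgwa_piM IHk.
Qed.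

Lemma tgwa_pi_sum m (c : 'I_m -> K) (F : 'I_m -> tgwc D) :
  tgwa_pi (\sum_k c k *: F k) = \sum_k c k *: tgwa_pi (F k).
Proof.
rewrite (big_morph _ (@tgwa_piD _ _ _ D) tgwa_pi0).
by apply: eq_bigr => k _; rewrite tgwa_piZ.
Qed.

Lemma tgwc_RZ c r : tgwc_R D (c *: r) = c *: tgwc_R D r.
Proof. by rewrite -{1}[r]mul1r scalerAl; apply: tgwc_RM. Qed.

Lemma sum_tgwc_R m (c : 'I_m -> K) (F : 'I_m -> R) :
  \sum_k c k *: rep_R M (F k) = rep_R M (\sum_k c k *: F k).
Proof.
rewrite (big_morph _ (rep_RD M) (rep_R0 M)).
by apply: eq_bigr => k _; rewrite -[rep_R M (_ *: _)]/(tgwc_R D _) tgwc_RZ.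
Qed.

Lemma homog_exp d (a : tgwc D) k : homog d a -> homog (d *+ k) (a ^+ k).
Proof.
move=> ha; elim: k => [|k IHk].
  by rewrite mulr0n expr0 -(rep_R1 M); apply: homog_R.
by rewrite mulrS exprS; apply: homog_M.
Qed.

Lemma homog_sum d m (c : 'I_m -> K) (F : 'I_m -> tgwc D) :
  (forall k, homog d (F k)) -> homog d (\sum_k c k *: F k).
Proof.
move=> hF; apply: (big_ind (homog d)); first exact: homog_0.
  by move=> a b; apply: homog_D.
by move=> k _; apply: homogZ.
Qed.

Lemma mon_nseq (A : pzRingType) (N : tgw_rep D A) l k : mon N (nseq k l) = gen N l ^+ k.
Proof. by rewrite /mon big_nseq -Monoid.iteropE. Qed.

Lemma wdeg_nseq l k : wdeg (nseq k l : seq ('I_n + 'I_n)) = letter_deg l *+ k.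
Proof. by rewrite /wdeg big_nseq -Monoid.iteropE. Qed.

Lemma serre_sum_R i j m (c : 'I_m.+1 -> K) :
  rep_R M (\sum_(k < m.+1) c k *: (mu D i j ^+ k *: (sigmaV D j (tprod D i m) * tau i k (t j)))) = 0
  <-> \sum_(k < m.+1) (c k * mu D i j ^+ k) *: tau i k (t j) = 0.
Proof.
have -> : \sum_(k < m.+1) c k *: (mu D i j ^+ k *: (sigmaV D j (tprod D i m) * tau i k (t j)))
   = sigmaV D j (tprod D i m) * \sum_(k < m.+1) (c k * mu D i j ^+ k) *: tau i k (t j).
  by rewrite mulr_sumr; apply: eq_bigr => k _; rewrite scalerA scalerAr.
have T0 : sigmaV D j (tprod D i m) != 0.
  rewrite (letter_twist_eq0 D (inr j)); elim: m {c} => [|m IHm] /=; first exact: oner_neq0.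
  by rewrite (domain_mulf_eq0 R_domain) (letter_twist_eq0 D (inr i)) negb_or IHm tgw_t_neq0.
split=> [/(rep_R_eq0 R_embeds)/eqP|->]; last by rewrite mulr0; apply: rep_R0.
by rewrite (domain_mulf_eq0 R_domain) (negPf T0) => /eqP.
Qed.

(** The left hand side is homogeneous of degree m e_i + e_j, and its product with
    Y_j Y_i^m is the right hand side times a nonzero element of [R]. *)
Lemma serre_X_eq0 i j m (c : 'I_m.+1 -> K) : i != j ->
  \sum_(k < m.+1) c k *: (tgwa_X D i ^+ (m - k) * tgwa_X D j * tgwa_X D i ^+ k) = 0
  <-> \sum_(k < m.+1) (c k * mu D i j ^+ k) *: tau i k (t j) = 0.
Proof.
move=> ij.
pose F k := rep_X M i ^+ (m - k) * rep_X M j * rep_X M i ^+ k.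
pose w := inr j :: nseq m (inr i) : seq ('I_n + 'I_n).
pose d : 'rV[int]_n := delta_mx 0 i *+ m + delta_mx 0 j.
have hS : homog d (\sum_(k < m.+1) c k *: F k).
  apply: homog_sum => k.
  have -> : d = delta_mx 0 i *+ (m - k) + delta_mx 0 j + delta_mx 0 i *+ k.
    by rewrite addrAC -mulrnDr subnK // -ltnS.
  by apply: homog_M; [apply: homog_M|]; try apply: homog_exp; apply: homog_X.
have hw : wdeg w = - d.
  by rewrite wdeg_cons wdeg_nseq /= /d opprD mulNrn addrC.
have <- : tgwa_pi (\sum_(k < m.+1) c k *: F k) =
    \sum_(k < m.+1) c k *: (tgwa_X D i ^+ (m - k) * tgwa_X D j * tgwa_X D i ^+ k).
  by rewrite tgwa_pi_sum; apply: eq_bigr => k _; rewrite !tgwa_piM !tgwa_piX.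
rewrite (tgwa_pi_eq0_left R_domain R_embeds hS hw) -serre_sum_R -sum_tgwc_R.
suff -> : mon M w * (\sum_(k < m.+1) c k *: F k) = \sum_(k < m.+1)
    c k *: rep_R M (mu D i j ^+ k *: (sigmaV D j (tprod D i m) * tau i k (t j))) by [].
rewrite mulr_sumr; apply: eq_bigr => k _.
rewrite -tgwc_scaleAr mon_cons mon_nseq; congr (_ *: _).
have := serre_term_X M (m - k) k ij.
by rewrite subnK // -ltnS.
Qed.

(** Here the sum is multiplied by X_i^m X_j from the right, which produces the same
    element of [R] as for the X's. *)
Lemma serre_Y_eq0 i j m (c : 'I_m.+1 -> K) : i != j ->
  \sum_(k < m.+1) c k *: (tgwa_Y D i ^+ k * tgwa_Y D j * tgwa_Y D i ^+ (m - k)) = 0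
  <-> \sum_(k < m.+1) (c k * mu D i j ^+ k) *: tau i k (t j) = 0.
Proof.
move=> ij.
pose F k := rep_Y M i ^+ k * rep_Y M j * rep_Y M i ^+ (m - k).
pose w := nseq m (inl i) ++ [:: inl j] : seq ('I_n + 'I_n).
pose d : 'rV[int]_n := (- delta_mx 0 i) *+ m + (- delta_mx 0 j).
have hS : homog d (\sum_(k < m.+1) c k *: F k).
  apply: homog_sum => k.
  have -> : d = (- delta_mx 0 i) *+ k + (- delta_mx 0 j) + (- delta_mx 0 i) *+ (m - k).
    by rewrite addrAC -mulrnDr subnKC // -ltnS.
  by apply: homog_M; [apply: homog_M|]; try apply: homog_exp; apply: homog_Y.
have hw : wdeg w = - d.
  by rewrite wdeg_cat wdeg_nseq wdeg_cons /wdeg big_nil addr0 /= /d opprD mulNrn !opprK.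
have <- : tgwa_pi (\sum_(k < m.+1) c k *: F k) =
    \sum_(k < m.+1) c k *: (tgwa_Y D i ^+ k * tgwa_Y D j * tgwa_Y D i ^+ (m - k)).
  by rewrite tgwa_pi_sum; apply: eq_bigr => k _; rewrite !tgwa_piM !tgwa_piX.
rewrite (tgwa_pi_eq0_right R_domain R_embeds hS hw) -serre_sum_R -sum_tgwc_R.
suff -> : (\sum_(k < m.+1) c k *: F k) * mon M w = \sum_(k < m.+1)
    c k *: rep_R M (mu D i j ^+ k *: (sigmaV D j (tprod D i m) * tau i k (t j))) by [].
rewrite mulr_suml; apply: eq_bigr => k _.
rewrite -tgwc_scaleAl mon_cat mon_nseq mon_cons mon_nil mulr1; congr (_ *: _).
have := serre_term_Y M (m - k) k ij.
by rewrite subnK // -ltnS.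
Qed.

End SerreSums.

(** * Minimal polynomials *)

Section PolyAct.
Variables (K : fieldType) (V : lmodType K) (f : {linear V -> V}).
Implicit Types (p q : {poly K}) (v : V).

Lemma poly_act_widen p v N : (size p <= N)%N ->
  poly_act p f v = \sum_(k < N) p`_k *: iter k f v.
Proof.
move=> pN; rewrite /poly_act (big_ord_widen N (fun k => p`_k *: iter k f v) pN).
rewrite big_mkcond; apply: eq_bigr => k _; case: ltnP => // pk.
by rewrite nth_default ?scale0r.
Qed.

Lemma poly_actZ c p v : poly_act (c *: p) f v = c *: poly_act p f v.
Proof.
rewrite (@poly_act_widen _ _ (size p)) ?size_scale_leq // scaler_sumr.
by apply: eq_bigr => k _; rewrite coefZ scalerA.
Qed.

Lemma poly_act_linear p c u v :
  poly_act p f (c *: u + v) = c *: poly_act p f u + poly_act p f v.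
Proof.
rewrite scaler_sumr -big_split; apply: eq_bigr => k _ /=.
suff -> : iter k f (c *: u + v) = c *: iter k f u + iter k f v.
  by rewrite scalerDr !scalerA mulrC.
by elim: (k : nat) => //= m ->; rewrite linearP.
Qed.

Lemma poly_act0 p : poly_act p f 0 = 0.
Proof.
rewrite /poly_act big1 // => k _.
suff -> : iter k f 0 = 0 by rewrite scaler0.
by elim: (k : nat) => //= m ->; rewrite linear0.
Qed.

Lemma poly_act_lin_span p (W : V -> Prop) :
  (forall w, W w -> poly_act p f w = 0) -> annihilates p f (lin_span W).
Proof.
move=> pW _ [N [c [s [Ws ->]]]].
apply: (big_ind (fun w => poly_act p f w = 0)); first exact: poly_act0.
  by move=> u v u0 v0; rewrite -[u]scale1r poly_act_linear u0 v0 scaler0 addr0.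
by move=> k _; rewrite -[_ *: _]addr0 poly_act_linear poly_act0 pW // scaler0 addr0.
Qed.

Lemma is_min_poly_min_poly (W : V -> Prop) q :
  q \is monic -> annihilates q f W -> is_min_poly f W (min_poly f W).
Proof.
move=> qm qW; rewrite /min_poly; case: pselect => [h|[]]; first exact: (projT2 (cid h)).
pose P N := `[< exists p, [/\ p \is monic, annihilates p f W & size p = N] >].
have exP : exists N, P N by exists (size q); apply/asboolP; exists q.
case: (ex_minnP exP) => N /asboolP [p [pm pW sp]] minN.
exists p; split=> // q' q'm q'W; rewrite sp; apply: minN; apply/asboolP.
by exists q'.
Qed.

(** N + 1 iterates of [f] in the span of N vectors are linearly dependent; the
    coefficients of [p] are a nonzero row vector in the kernel of the matrix of
    coordinates. *)
Lemma fin_dim_annihilated (W : V -> Prop) v :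
  fin_dim W -> (forall k, W (iter k f v)) -> exists2 p, p != 0 & poly_act p f v = 0.
Proof.
move=> [N [s [_ hs]]] Wv.
have [C hC] : exists C : 'M[K]_(N.+1, N), forall k : 'I_N.+1, iter k f v = \sum_l C k l *: s l.
  have /choice [c hc] : forall k : 'I_N.+1, exists c : 'I_N -> K,
    iter k f v = \sum_l c l *: s l by move=> k; apply: hs.
  by exists (\matrix_(k, l) c k l) => k; rewrite hc; apply: eq_bigr => l _; rewrite mxE.
have kC : kermx C != 0.
  by rewrite kermx_eq0 /row_free neq_ltn (leq_ltn_trans (rank_leq_col C)).
have [k rk] : exists k, row k (kermx C) != 0.
  by apply/existsP; apply: contraNT kC; rewrite negb_exists => /forallP h;
     apply/eqP/row_matrixP => k; have := h k; rewrite negbK row0 => /eqP.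
set u := row k (kermx C) in rk.
have uC : u *m C = 0 by apply/sub_kermxP; apply: row_sub.
exists (\poly_(a < N.+1) u 0 (inord a)).
  apply: contraNneq rk => p0; apply/eqP/rowP => a; rewrite !mxE.
  have := congr1 (fun p : {poly K} => p`_a) p0.
  by rewrite coef_poly coef0 ltn_ord inord_val !mxE.
rewrite (poly_act_widen _ (size_poly _ _)).
under eq_bigr => a _.
  rewrite coef_poly ltn_ord inord_val hC scaler_sumr.
  under eq_bigr => l _ do rewrite scalerA.
  over.
rewrite exchange_big big1 // => l _; rewrite -scaler_suml.
have := congr1 (fun x : 'rV_N => x 0 l) uC; rewrite !mxE => ->.
by rewrite scale0r.
Qed.

End PolyAct.

Section TGWMinPoly.
Variables (K : fieldType) (R : comAlgType K) (n : nat) (D : tgw_datum R n).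
Hypothesis lfin : locally_finite D.
Implicit Types (i j : 'I_n) (p q : {poly K}).

Lemma iter_sigma_tgw_V i j k : tgw_V D i j (iter k (sigma D i) (tgw_t D j)).
Proof.
exists 1%N, (fun=> 1), (fun=> iter k (sigma D i) (tgw_t D j)); split.
  by move=> _; exists (Posz k).
by rewrite big_ord_recl big_ord0 addr0 scale1r.
Qed.

Lemma poly_act_comm p i (g : {linear R -> R}) r :
  (forall s, g (sigma D i s) = sigma D i (g s)) ->
  poly_act p (sigma D i) (g r) = g (poly_act p (sigma D i) r).
Proof.
move=> gs; rewrite [in RHS]/poly_act raddf_sum; apply: eq_bigr => k _ /=.
rewrite linearZ; congr (_ *: _).
by elim: (k : nat) => //= m ->; rewrite gs.
Qed.

(** A polynomial in sigma_i commutes with all the powers of sigma_i, so it is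
    enough that it kills the generator t_j. *)
Lemma annihilates_tgw_V i j q :
  poly_act q (sigma D i) (tgw_t D j) = 0 -> annihilates q (sigma D i) (tgw_V D i j).
Proof.
move=> qt; apply: poly_act_lin_span => _ [[k|k] ->].
  elim: k => [|k IHk] //=.
  by rewrite (@poly_act_comm q i (sigma D i)) // IHk raddf0.
rewrite /sigma_pow; elim: (k.+1) => [|m IHm] //=.
rewrite (@poly_act_comm q i (sigmaV D i)) ?IHm ?raddf0 // => s.
by rewrite /= sigmaK sigmaVK.
Qed.

Lemma min_poly_mxP i j : let p := min_poly_mx D i j in
  [/\ p \is monic, poly_act p (sigma D i) (tgw_t D j) = 0 &
      forall q, q != 0 -> poly_act q (sigma D i) (tgw_t D j) = 0 ->
        (size p <= size q)%N].
Proof.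
have normalize q : q != 0 -> poly_act q (sigma D i) (tgw_t D j) = 0 ->
    let q' := (lead_coef q)^-1 *: q in
    [/\ q' \is monic, annihilates q' (sigma D i) (tgw_V D i j) & size q' = size q].
  move=> q0 qt; have l0 : (lead_coef q)^-1 != 0 by rewrite invr_eq0 lead_coef_eq0.
  split; last by rewrite size_scale.
    by rewrite monicE lead_coefZ mulVf // lead_coef_eq0.
  by apply: annihilates_tgw_V; rewrite poly_actZ qt scaler0.
have [q q0 qt] := fin_dim_annihilated (lfin i j) (iter_sigma_tgw_V i j).
have [qm qV _] := normalize q q0 qt.
rewrite /min_poly_mx mxE /=.
have [pm pV minp] := is_min_poly_min_poly qm qV.
split=> //; first by apply: pV; apply: (iter_sigma_tgw_V i j 0).
by move=> q' q'0 q't; have [q'm q'V <-] := normalize q' q'0 q't; apply: minp.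
Qed.

End TGWMinPoly.

Section PolynomialRelations.
Variables (K : fieldType) (R : comAlgType K) (n : nat) (D : tgw_datum R n).
Hypothesis R_domain : GRing.integral_domain_axiom R.
Hypothesis lfin : locally_finite D.
Implicit Types (i j : 'I_n) (p q : {poly K}).

Notation tau i k := (iter k (sigmaV D i)).
Notation t := (tgw_t D).

(** Applying sigma_i^m turns the negative powers of sigma_i into a polynomial whose
    coefficients come in the reverse order. *)
Lemma sum_tau i m (d : nat -> K) r :
  \sum_(k < m.+1) d k *: tau i k r =
  tau i m (poly_act (\poly_(a < m.+1) d (m - a)%N) (sigma D i) r).
Proof.
rewrite (poly_act_widen _ _ (size_poly _ _)) (big_morph _ (tauD D i m) (tau0 D i m)).
rewrite [RHS](reindex_inj rev_ord_inj); apply: eq_bigr => k _ /=.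
have km : (k <= m)%N by rewrite -ltnS.
rewrite subSS coef_poly ltnS leq_subr subKn // tauZ; congr (_ *: _).
by have := iterD k (m - k) (sigmaV D i); rewrite subnKC // => ->; rewrite tau_sigma.
Qed.

Lemma sum_tau_eq0 i m (d : nat -> K) r :
  \sum_(k < m.+1) d k *: tau i k r = 0 <->
  poly_act (\poly_(a < m.+1) d (m - a)%N) (sigma D i) r = 0.
Proof.
rewrite sum_tau; split=> [h|->]; last exact: tau0.
by apply: (@tau_inj _ _ _ D i m); rewrite h tau0.
Qed.

Lemma min_poly_size i j : size (min_poly_mx D i j) = (poly_deg (min_poly_mx D i j)).+1.
Proof.
have [pm _ _] := min_poly_mxP lfin i j.
by rewrite /poly_deg prednK // lt0n size_poly_eq0 monic_neq0.
Qed.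

Lemma min_poly_deg_gt0 i j : (0 < poly_deg (min_poly_mx D i j))%N.
Proof.
have [pm pt _] := min_poly_mxP lfin i j; have sp := min_poly_size i j.
rewrite lt0n; apply: contraTneq (tgw_t_neq0 D j) => m0; rewrite negbK.
rewrite m0 in sp; rewrite /poly_act sp big_ord_recl big_ord0 addr0 /= in pt.
move: pm; rewrite monicE lead_coefE sp /= => /eqP p1.
by rewrite p1 scale1r in pt; rewrite pt.
Qed.

Lemma min_poly_deg1P i j :
  poly_deg (min_poly_mx D i j) = 1%N <-> exists g, sigma D i (t j) = g *: t j.
Proof.
have [pm pt minp] := min_poly_mxP lfin i j; have sp := min_poly_size i j.
split=> [m1|[g sg]].
  rewrite m1 in sp; move: pm; rewrite monicE lead_coefE sp /= => /eqP p1.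
  rewrite /poly_act sp !big_ord_recl big_ord0 addr0 /= p1 scale1r in pt.
  exists (- (min_poly_mx D i j)`_0); rewrite scaleNr.
  by apply/eqP; rewrite -addr_eq0 addrC pt.
have : (size (min_poly_mx D i j) <= size ('X - g%:P)%R)%N.
  apply: minp; first by rewrite polyXsubC_eq0.
  rewrite /poly_act size_XsubC !big_ord_recl big_ord0 addr0 /= !coefB !coefX !coefC /=.
  by rewrite sub0r subr0 scale1r sg scaleNr addNr.
rewrite size_XsubC sp ltnS => m1; apply/eqP; rewrite eqn_leq m1.
exact: min_poly_deg_gt0.
Qed.

(** If sigma_i(t_j) = g t_j, then t_j occurs as a factor on both sides of the
    compatibility condition; cancelling it makes t_i an eigenvector of sigma_j^-1. *)
Lemma sigma_eigen_sym i j : i != j ->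
  (exists g, sigma D i (t j) = g *: t j) -> exists g, sigma D j (t i) = g *: t i.
Proof.
move=> ij [g sg].
have g0 : g != 0.
  apply: contraNneq (tgw_t_neq0 D j) => g0.
  by rewrite -[t j](sigmaK D i) sg g0 scale0r raddf0.
have sVg : sigmaV D i (t j) = g^-1 *: t j.
  by apply: (canLR (sigmaK D i)); rewrite linearZ /= sg scalerA mulVf ?scale1r.
have := tgw_t_mul D ij; rewrite sVg -scalerAr scalerA scalerAl => e.
set c := (X in X *: _ * _) in e; exists c.
have : (t i - c *: sigmaV D j (t i)) * t j == 0 by rewrite mulrBl e subrr.
rewrite (domain_mulf_eq0 R_domain) (negPf (tgw_t_neq0 D j)) orbF subr_eq0 => /eqP {1}->.
by rewrite linearZ /= sigmaVK.
Qed.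

Lemma serre_min_poly i j : i != j ->
  let p := min_poly_mx D i j in let m := poly_deg p in
  \sum_(k < m.+1) (p`_(m - k) * mu D i j ^- k * mu D i j ^+ k) *: tau i k (t j) = 0.
Proof.
move=> ij p m; have [_ pt _] := min_poly_mxP lfin i j.
rewrite (eq_bigr (fun k : 'I_m.+1 => p`_(m - k) *: tau i k (t j))); last first.
  by move=> k _; rewrite mulfVK // expf_neq0 // mu_neq0.
apply/(sum_tau_eq0 i m (fun k => p`_(m - k))); rewrite -[RHS]pt; congr poly_act.
apply/polyP => a; rewrite coef_poly -(min_poly_size i j) -/p; case: ltnP => [ap|pa].
  by rewrite subKn // -ltnS -(min_poly_size i j).
by rewrite nth_default.
Qed.

(** A relation gives a polynomial of degree at most l that kills t_j, and such a
    polynomial is 0 because the minimal polynomial has a larger degree. *)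
Lemma min_poly_indep i j l (c : 'I_l.+1 -> K) : i != j ->
  (l < poly_deg (min_poly_mx D i j))%N ->
  \sum_(k < l.+1) (c k * mu D i j ^+ k) *: tau i k (t j) = 0 -> forall k, c k = 0.
Proof.
move=> ij lm.
rewrite (eq_bigr (fun k : 'I_l.+1 => (c (inord k) * mu D i j ^+ k) *: tau i k (t j)));
  last by move=> k _; rewrite inord_val.
move/(sum_tau_eq0 i l (fun k => c (inord k) * mu D i j ^+ k)).
set q := \poly_(a < _) _ => qt k.
have [_ _ minp] := min_poly_mxP lfin i j.
have q0 : q = 0.
  apply/eqP; apply: contraTT lm => /minp/(_ qt); rewrite min_poly_size -leqNgt => h.
  by rewrite -ltnS (leq_trans h) ?size_poly.
have := congr1 (fun p : {poly K} => p`_(l - k)) q0.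
have kl : (k <= l)%N by rewrite -ltnS.
rewrite coef_poly coef0 ltnS leq_subr subKn // inord_val => /eqP.
by rewrite mulf_eq0 expf_eq0 (negPf (mu_neq0 D ij)) andbF orbF => /eqP.
Qed.

End PolynomialRelations.

Theorem theorem4p4 (K : fieldType) (R : comAlgType K) (n : nat)
    (D : tgw_datum R n)
    (n_gt0 : (0 < n)%N)
    (R_domain : GRing.integral_domain_axiom R)
    (R_embeds : injective (tgwc_R D))
    (lfin : locally_finite D) :
  let P := min_poly_mx D in
  let X := tgwa_X D in
  let Y := tgwa_Y D in
  let m := fun i j => poly_deg (P i j) in
  let lambda := fun i j k => (P i j)`_(m i j - k) in
  [/\ poly_cartan P,
      (forall i j : 'I_n, i != j ->
         [/\ P i j = 'X^(m i j)
               + \sum_(1 <= k < (m i j).+1) lambda i j k *: 'X^(m i j - k),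
             X i ^+ m i j * X j
               + \sum_(1 <= k < (m i j).+1)
                   (lambda i j k * mu D i j ^- k)
                     *: (X i ^+ (m i j - k) * X j * X i ^+ k) = 0 &
             Y j * Y i ^+ m i j
               + \sum_(1 <= k < (m i j).+1)
                   (lambda i j k * mu D i j ^- k)
                     *: (Y i ^+ k * Y j * Y i ^+ (m i j - k)) = 0]) &
      (forall i j : 'I_n, i != j -> forall l : nat, (l < m i j)%N ->
         lin_indep (fun k : 'I_l.+1 => X i ^+ (l - k) * X j * X i ^+ k) /\
         lin_indep (fun k : 'I_l.+1 => Y i ^+ (l - k) * Y j * Y i ^+ k))].
Proof.
move=> P X Y m lambda.
(* The term k = 0 of each sum is the leading one, since p_ij is monic. *)
have split0 (W : nmodType) k (F : nat -> W) :
    F 0%N + \sum_(1 <= a < k.+1) F a = \sum_(a < k.+1) F a.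
  by rewrite -(big_mkord xpredT F) [RHS]big_ltn.
have lambda0 i j : lambda i j 0%N = 1.
  have [pm _ _] := min_poly_mxP lfin i j.
  by move: pm; rewrite monicE => /eqP; rewrite /lambda subn0.
split.
- move=> i j ij; split; first exact: min_poly_deg_gt0.
  have ji : j != i by rewrite eq_sym.
  split=> /(min_poly_deg1P lfin) h; apply/(min_poly_deg1P lfin);
    exact: sigma_eigen_sym h.
- move=> i j ij; split.
  + have -> : 'X^(m i j) = lambda i j 0%N *: 'X^(m i j - 0) :> {poly K}.
      by rewrite lambda0 scale1r subn0.
    rewrite (split0 _ _ (fun k => lambda i j k *: 'X^(m i j - k))).
    rewrite (reindex_inj rev_ord_inj) /= -[LHS]coefK poly_def.
    rewrite (min_poly_size lfin); apply: eq_bigr => a _.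
    by rewrite subSS /lambda subKn // -ltnS.
  + have -> : X i ^+ m i j * X j =
        (lambda i j 0%N * mu D i j ^- 0) *: (X i ^+ (m i j - 0) * X j * X i ^+ 0).
      by rewrite lambda0 expr0 invr1 mulr1 scale1r subn0 mulr1.
    rewrite (split0 _ _ (fun k => (lambda i j k * mu D i j ^- k)
                     *: (X i ^+ (m i j - k) * X j * X i ^+ k))).
    by apply/(serre_X_eq0 R_domain R_embeds _ ij); apply: serre_min_poly.
  + have -> : Y j * Y i ^+ m i j =
        (lambda i j 0%N * mu D i j ^- 0) *: (Y i ^+ 0 * Y j * Y i ^+ (m i j - 0)).
      by rewrite lambda0 expr0 invr1 mulr1 scale1r subn0 mul1r.
    rewrite (split0 _ _ (fun k => (lambda i j k * mu D i j ^- k)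
                     *: (Y i ^+ k * Y j * Y i ^+ (m i j - k)))).
    by apply/(serre_Y_eq0 R_domain R_embeds _ ij); apply: serre_min_poly.
- move=> i j ij l lm; split=> c.
    by move=> /(serre_X_eq0 R_domain R_embeds _ ij); apply: min_poly_indep.
  (* The exponents run in the opposite order from those in the relation for Y. *)
  rewrite (reindex_inj rev_ord_inj) /=.
  rewrite (eq_bigr (fun k : 'I_l.+1 => c (rev_ord k) *: (Y i ^+ k * Y j * Y i ^+ (l - k)))).
    move=> /(serre_Y_eq0 R_domain R_embeds (fun k => c (rev_ord k)) ij).
    move=> /(min_poly_indep lfin ij lm) h k.
    by rewrite -[k]rev_ordK.
  by move=> k _; rewrite subSS subKn // -ltnS.
Qed.
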